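(* Let $(\Omega,\mathcal{F},\mathbb{P})$ be a complete probability space, $t_0<T$, $x_0$ a random variable and $a$ a stochastic process on $[t_0,T]$, and let $x(t,\omega)=x_0(\omega)\mathrm{e}^{\int_{t_0}^t a(s,\omega)\mathrm{d} s}$. Assume: (H1) $a\in \mathrm{L}^2([t_0,T]\times\Omega)$; (H2) for every $N\ge1$, $x_0$ and $(\xi_1,\ldots,\xi_N)$ are absolutely continuous and independent; (H3) the density $f_0$ of $x_0$ is continuous and bounded on $D(x_0)$; (H4) there is a constant $C$ with $\|\mathrm{e}^{-K_a(t,\pmb{\xi}_N)}\|_{\mathrm{L}^2(\Omega)}\le C$ for all $N\ge1$ and $t\in[t_0,T]$. Then for all $x\in\mathbb{R}$ and $t\in[t_0,T]$, the sequence \[ f_1^N(x,t)=\int_{\mathbb{R}^N} f_0\big(x\,\mathrm{e}^{-K_a(t,\pmb{\xi}_N)}\big)f_{\pmb{\xi}_N}(\pmb{\xi}_N)\,\mathrm{e}^{-K_a(t,\pmb{\xi}_N)}\,\mathrm{d}\pmb{\xi}_N \] converges to $f_1(x,t)$, where $f_1(\cdot,t)$ is a probability density of $x(t,\cdot)$.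
   Context: Karhunen–Loève expansion: for $a\in \mathrm{L}^2([t_0,T]\times\Omega)$ write $a(t,\omega)=\mu_a(t)+\sum_{j=1}^\infty\sqrt{\nu_j}\,\phi_j(t)\xi_j(\omega)$ (convergence in $\mathrm{L}^2([t_0,T]\times\Omega)$), where $\mu_a(t)=\mathbb{E}[a(t)]$, $\{(\nu_j,\phi_j)\}$ are the (nonnegative) eigenvalue/eigenfunction pairs of the covariance operator $\mathcal{C}f(t)=\int_{t_0}^T\mathrm{Cov}[a(t),a(s)]f(s)\,\mathrm{d} s$ on $\mathrm{L}^2([t_0,T])$ with $\{\phi_j\}$ an orthonormal basis, and $\xi_j$ are zero-mean, unit-variance, pairwise uncorrelated random variables; pairs may be enumerated in any order, and if only finitely many eigenvalues are nonzero, vectors stop at that number. $\pmb{\xi}_N=(\xi_1,\ldots,\xi_N)$, $f_{\pmb{\xi}_N}$ its density, $K_a(t,\pmb{\xi}_N)=\int_{t_0}^t\big(\mu_a(s)+\sum_{j=1}^N\sqrt{\nu_j}\phi_j(s)\xi_j\big)\mathrm{d} s$. $D(x_0)=(0,\infty)$ if $x_0>0$ a.s., $D(x_0)=(-\infty,0)$ if $x_0<0$ a.s., and $D(x_0)=\mathbb{R}$ otherwise. *)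

(* Defs.v *)
From HB Require Import structures.
From mathcomp Require Import all_boot all_order all_algebra.
From mathcomp Require Import all_classical all_reals all_analysis.
Set Implicit Arguments. Unset Strict Implicit. Unset Printing Implicit Defensive.
Import Order.TTheory GRing.Theory Num.Theory.
Import numFieldNormedType.Exports.
Local Open Scope classical_set_scope.
Local Open Scope ring_scope.

Section defs.
Context {R : realType}.
Local Notation lam := (@lebesgue_measure R).

(* Lebesgue integral over R^n of an extended-real valued function,
   written as an iterated integral (for nonnegative measurable integrands
   this is the integral w.r.t. n-dimensional Lebesgue measure, by Tonelli).
   R^n is represented by n.-tuple R (with its product sigma-algebra). *)
Fixpoint iter_int (n : nat) : (n.-tuple R -> \bar R) -> \bar R :=
  match n with
  | 0 => fun g => g [tuple]
  | n'.+1 => fun g =>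
      (\int[lam]_(y in [set: R]) iter_int (fun v : n'.-tuple R => g [tuple of y :: v]))%E
  end.

Context {d : measure_display} {Omega : measurableType d} (P : probability Omega R).

Definition is_density (X : Omega -> R) (f : R -> R) : Prop :=
  measurable_fun setT X /\ measurable_fun setT f /\ (forall x, 0 <= f x) /\
  forall A : set R, measurable A ->
    P (X @^-1` A) = (\int[lam]_(x in A) (f x)%:E)%E.

Definition is_density_vec (n : nat) (X : Omega -> n.-tuple R) (f : n.-tuple R -> R) : Prop :=
  measurable_fun setT X /\ measurable_fun setT f /\ (forall v, 0 <= f v) /\
  forall B : set (n.-tuple R), measurable B ->
    P (X @^-1` B) = iter_int (fun v => (\1_B v * f v)%:E).

Definition indep_rv_vec (n : nat) (X : Omega -> R) (Y : Omega -> n.-tuple R) : Prop :=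
  forall (A : set R) (B : set (n.-tuple R)), measurable A -> measurable B ->
    P (X @^-1` A `&` Y @^-1` B) = (P (X @^-1` A) * P (Y @^-1` B))%E.

Definition Dx0 (x0 : Omega -> R) : set R :=
  [set y | ({ae P, forall w, 0 < x0 w} -> 0 < y) /\
           ({ae P, forall w, x0 w < 0} -> y < 0)].

Definition mean_fun (a : R -> Omega -> R) (t : R) : R := Rintegral P setT (a t).
Definition cov_fun (a : R -> Omega -> R) (t s : R) : R :=
  Rintegral P setT (fun w => (a t w - mean_fun a t) * (a s w - mean_fun a s)).

(* number of KL terms actually used when truncating at N:
   L = None : infinitely many nonzero eigenvalues; L = Some M : exactly M. *)
Definition neff (L : option nat) (N : nat) : nat :=
  if L is Some M then minn N M else N.

Definition active (L : option nat) (j : nat) : Prop :=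
  if L is Some M then (j < M)%N else True.

Definition KL_expansion (t0 T : R) (a : R -> Omega -> R) (L : option nat)
  (nu : nat -> R) (phi : nat -> R -> R) (xi : nat -> Omega -> R) : Prop :=
  (forall j, 0 <= nu j) /\
  (forall M, L = Some M -> forall j, (j < M)%N -> 0 < nu j) /\
  (forall j, ~ active L j -> nu j = 0) /\
  (L = None -> forall n, exists j, (n <= j)%N /\ nu j != 0) /\
  (forall j, measurable_fun `[t0, T] (phi j)) /\
  (forall i j, (\int[lam]_(s in `[t0, T]) (phi i s * phi j s)%:E)%E
               = (if i == j then 1 else 0)%:E) /\
  (forall f : R -> R, measurable_fun `[t0, T] f ->
     (\int[lam]_(s in `[t0, T]) (f s ^+ 2)%:E < +oo)%E ->
     (forall j, (\int[lam]_(s in `[t0, T]) (f s * phi j s)%:E)%E = 0%E) ->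
     {ae lam, forall s, t0 <= s <= T -> f s = 0}) /\
  (forall j, {ae lam, forall t, t0 <= t <= T ->
     Rintegral lam `[t0, T] (fun s => cov_fun a t s * phi j s) = nu j * phi j t}) /\
  (forall j, active L j -> measurable_fun setT (xi j)) /\
  (forall j, active L j -> (\int[P]_w (xi j w)%:E)%E = 0%E) /\
  (forall j, active L j -> (\int[P]_w (xi j w ^+ 2)%:E)%E = 1%E) /\
  (forall i j, active L i -> active L j -> i <> j ->
     (\int[P]_w (xi i w * xi j w)%:E)%E = 0%E) /\
  ((fun N => (\int[(lam \x P)%E]_(p in `[t0, T] `*` [set: Omega])
       ((a p.1 p.2 - (mean_fun a p.1 +
          \sum_(j < neff L N) Num.sqrt (nu j) * phi j p.1 * xi j p.2)) ^+ 2)%:E)%E)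
     @ \oo --> 0%E).

Definition xi_vec (xi : nat -> Omega -> R) (n : nat) (w : Omega) : n.-tuple R :=
  [tuple xi (nat_of_ord j) w | j < n].

Definition K_a (t0 : R) (a : R -> Omega -> R) (nu : nat -> R) (phi : nat -> R -> R)
  (n : nat) (t : R) (v : n.-tuple R) : R :=
  Rintegral lam `[t0, t]
    (fun s => mean_fun a s + \sum_(j < n) Num.sqrt (nu j) * phi j s * tnth v j).

Definition sol (t0 : R) (x0 : Omega -> R) (a : R -> Omega -> R) (t : R) (w : Omega) : R :=
  x0 w * expR (Rintegral lam `[t0, t] (fun s => a s w)).

Definition f1N (t0 : R) (a : R -> Omega -> R) (nu : nat -> R) (phi : nat -> R -> R)
  (f0 : R -> R) (n : nat) (fxi : n.-tuple R -> R) (x t : R) : \bar R :=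
  iter_int (fun v : n.-tuple R =>
    (f0 (x * expR (- K_a t0 a nu phi t v)) * fxi v * expR (- K_a t0 a nu phi t v))%:E).

End defs.

(* Main.v *)
(** Write K_N = K_a(t, xi_N) and K = int_{t0}^t a(s) ds. Tonelli turns the L2 convergence of the
    Karhunen-Loeve expansion into K_N -> K in L1(P), so bounded continuous functions of K_N
    converge in mean along every fast subsequence; independence of x0 and K_N therefore passes
    to K, and the law of x0 e^K has density E[f0 (x e^-K) e^-K]. The change of variables from
    the density of xi_N to expectations gives f1N(x) = E[f0 (x e^-K_N) e^-K_N]; for x in D(x0)
    the integrand is continuous in K_N and dominated by M e^-K_N, which (H4) makes uniformly
    integrable, so f1N(x) converges to the same expectation at K. *)
Require Import Defs.
From HB Require Import structures.
From mathcomp Require Import all_boot all_order all_algebra.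
From mathcomp Require Import all_classical all_reals all_analysis.
From mathcomp Require Import measurable_realfun lra.
Set Implicit Arguments.
Unset Strict Implicit.
Unset Printing Implicit Defensive.
Import Order.TTheory GRing.Theory Num.Theory.
Import numFieldNormedType.Exports.
Local Open Scope classical_set_scope.
Local Open Scope ring_scope.

(** The conclusion is pointwise in x, whereas a density is determined only almost everywhere. (H3)
    says nothing about [f0] off D(x0), where it is zero merely almost everywhere; the exceptional
    null set has to be followed through k -> x e^-k and through the affine form v -> K_N(v), which
    is the purpose of the lemmas on null sets. The density of the solution is accordingly glued from
    two pieces: the expectation at K on D(x0) with 0 added, and elsewhere a prescribed function [e]
    of integral zero.

    (H4) bounds the K_N only. Finiteness of the limiting expectation is therefore a result: it comes
    from the uniform second moment bound by cutting the integrand, passing to the limit in N, and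
    then removing the cut.

    L1 convergence acts on continuous test functions only, so independence reaches Borel sets
    through continuous ramps. Densities of xi_N enter through iterated integrals, so integration
    facts on R^n are obtained by induction on n. *)

Section lebesgue_affine.
Context {R : realType}.
Local Notation lam := (@lebesgue_measure R).

(** * Lebesgue measure under affine maps and dilations *)

Lemma measurable_affine (b c : R) : measurable_fun setT (fun y : R => b + c * y).
Proof. by apply: measurable_funD => //; apply: measurable_funM. Qed.

(** The right-hand side is itself a measure in [A], and it gives each half-open interval its length;
    this characterizes [lam]. *)
Lemma lebesgue_measure_affine (b c : R) (A : set R) : 0 < c -> measurable A ->
  lam A = (c%:E * lam ((fun y : R => (b + c * y)%R) @^-1` A))%E.
Proof.
move=> c0 mA; pose cc := NngNum (ltW c0).
pose f := (fun y : R => (b + c * y)%R) : measurableTypeR R -> measurableTypeR R.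
have mf : measurable_fun setT f by exact: measurable_affine.
have := @lebesgue_measure_unique R (mscale cc (pushforward lam f)).
move=> /(_ mf _ A mA) -> //=.
move=> _ [[p q]] _ <- /=; rewrite /mscale/= /pushforward.
have -> : f @^-1` `]p, q] = `](p - b) / c, (q - b) / c]%classic.
  apply/seteqP; split=> y /=; rewrite !in_itv/= ltr_pdivrMr// ler_pdivlMr//;
  by rewrite ltrBlDr lerBrDr [_ * c]mulrC [_ * y + _]addrC.
rewrite !lebesgue_measure_itv/= !lte_fin ltr_pM2r ?invr_gt0// ltrD2r.
case: ifPn => pq; last by rewrite mule0.
by rewrite -!EFinD -EFinM; congr EFin; rewrite -mulrBl opprB addrA subrK mulrC divfK// gt_eqF.
Qed.

Lemma lebesgue_null_affine (b c : R) (S : set R) : c != 0 -> measurable S ->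
  lam S = 0%E -> lam ((fun y : R => b + c * y) @^-1` S) = 0%E.
Proof.
move=> c0 mS S0; have mf b' c' := @measurable_affine b' c'.
have gt0 b' c' S' : 0 < c' -> measurable S' -> lam S' = 0%E ->
    lam ((fun y : R => b' + c' * y) @^-1` S') = 0%E.
  move=> c'0 mS' /eqP; rewrite (lebesgue_measure_affine b' c'0 mS') mule_eq0.
  by case/orP => [|/eqP//]; rewrite eqe gt_eqF.
have [c1|c1|/eqP] := ltgtP 0 c; [exact: gt0| |by rewrite eq_sym (negPf c0)].
(* A negative slope becomes positive after the reflection y -> -y, which preserves [lam]. *)
rewrite -lebesgue_measureN; last first.
  by rewrite -[X in measurable X]setTI; exact: mf.
rewrite /pushforward -(gt0 b (- c) S) ?oppr_gt0//; congr (lam _).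
by apply/seteqP; split=> y /=; rewrite mulrN mulNr.
Qed.

Lemma ge0_integral_scale (c : R) (A : set R) (h : R -> \bar R) : 0 < c ->
  measurable A -> measurable_fun setT h -> (forall x, 0 <= h x)%E ->
  (\int[lam]_(y in A) h y = \int[lam]_(x in [set x | A (x * c)%R]) (h (x * c)%R * c%:E))%E.
Proof.
move=> c0 mA mh h0; pose cc := NngNum (ltW c0).
pose f := (fun y : R => (0 + c * y)%R) : measurableTypeR R -> measurableTypeR R.
have mf : measurable_fun setT f by exact: measurable_affine.
have := @eq_measure_integral _ (measurableTypeR R) R A (mscale cc (pushforward lam f)).
move=> /(_ mf lam h) ->; last by move=> B mB _; exact: (lebesgue_measure_affine 0 c0 mB).
rewrite ge0_integral_mscale//; last exact: measurable_funS mh.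
rewrite ge0_integral_pushforward//; last exact: measurable_funS mh.
rewrite -ge0_integralZl_EFin; last 4 first.
- by rewrite -[X in measurable X]setTI; exact: mf.
- by move=> y _; exact: h0.
- by apply: measurable_funTS; apply: measurableT_comp.
- exact: ltW.
have E y : f y = y * c by rewrite /f add0r mulrC.
rewrite (_ : f @^-1` A = [set x | A (x * c)]); last first.
  by apply/seteqP; split => y /=; rewrite E.
by apply: eq_integral => y _ /=; rewrite E muleC.
Qed.

(* By Tonelli and scaling, the set is null for almost every positive multiple of x;
   replacing x by such a multiple translates the set. *)
Lemma lebesgue_null_log (x : R) (Z : set R) : x != 0 -> measurable Z -> lam Z = 0%E ->
  lam [set k | Z (x * expR (- k))] = 0%E.
Proof.
move=> x0 mZ Z0.
have mg : measurable_fun setT (fun p : R * R => p.1 * expR (- p.2)).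
  apply: measurable_funM => //.
  by apply: measurableT_comp => //; exact: measurableT_comp.
pose S u := [set k : R | Z (u * expR (- k))].
have mS u : measurable (S u).
  rewrite -[X in measurable X]setTI; apply: (_ : measurable_fun setT _) => //.
  by apply: measurable_funM => //; apply: measurableT_comp => //; exact: measurableT_comp.
pose h := fun p : R * R => (\1_Z (p.1 * expR (- p.2)) : R)%:E.
have mh : measurable_fun setT h.
  have mI : measurable_fun setT (\1_Z : R -> R) by exact: measurable_indic.
  by apply/measurable_EFinP; exact: (measurableT_comp mI mg).
have h0 p : (0 <= h p)%E by rewrite lee_fin.
have hu u : (\int[lam]_k h (u, k) = lam (S u))%E.
  transitivity (\int[lam]_k (\1_(S u) k : R)%:E)%E; first by [].
  by rewrite integral_indic ?setIT//; exact: mS.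
have : (\int[lam]_u \int[lam]_k h (u, k) = 0)%E.
  rewrite [LHS](@fubini_tonelli _ _ _ _ _ lam lam h mh h0).
  apply: integral0_eq => k _.
  transitivity (\int[lam]_u (\1_[set u | Z (u * expR (- k))] u : R)%:E)%E; first by [].
  rewrite integral_indic ?setIT//; last first.
    rewrite -[X in measurable X]setTI; apply: (_ : measurable_fun setT _) => //.
    exact: measurable_funM.
  have := @lebesgue_null_affine 0 (expR (- k)) Z.
  rewrite gt_eqF ?expR_gt0// => /(_ isT mZ Z0); apply: etrans.
  by congr (lam _); apply/seteqP; split => u /=; rewrite add0r mulrC.
under eq_integral do rewrite hu.
move=> I0.
have mSu : measurable_fun setT (fun u => lam (S u)).
  rewrite (_ : (fun u => lam (S u)) = fubini_F lam h); last by apply/funext => u; exact/esym/hu.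
  exact: measurable_fun_fubini_tonelli_F.
have : ae_eq lam setT (fun u => lam (S u)) (cst 0%E).
  apply/ae_eq_integral_abs => //; rewrite -[RHS]I0.
  by apply: eq_integral => u _; rewrite gee0_abs.
move=> [N [mN N0 SN]].
(* A good [u] of the same sign as [x] exists because the open interval between 0 and [x] consists of
   such points and has positive length. *)
have [u [ux Su]] : exists u, 0 < u / x /\ lam (S u) = 0%E.
  apply: contrapT => /forallNP H.
  have sub : [set u | 0 < u / x] `<=` N.
    by move=> u ux; apply: SN => /= Su; apply: (H u); split => //; exact: Su.
  have /eqP : lam `](Num.min x 0), (Num.max x 0)[ = 0%E.
    apply/eqP; rewrite -measure_le0 -N0 le_measure ?inE//.
    apply: subset_trans sub => u /=; rewrite in_itv/=.
    case: (ltgtP x 0) x0 => // x0 _ /andP[u1 u2]; last exact: divr_gt0.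
    by rewrite nmulr_rgt0 ?invr_lt0.
  rewrite lebesgue_measure_itv/= lte_fin.
  case: (ltgtP x 0) x0 => // x0 _; rewrite ?x0 -EFinD eqe; first by rewrite add0r oppr_eq0 lt_eqF.
  by rewrite subr0 gt_eqF.
(* Since u = x e^(ln (u / x)), the set for [x] is the set for [u] translated by ln (u / x). *)
rewrite -(@lebesgue_null_affine (ln (u / x)) 1 _ (oner_neq0 _) (mS u) Su).
have u0 : u != 0 by apply: contraTneq ux => ->; rewrite mul0r ltxx.
have E k : u * expR (- (ln (u / x) + 1 * k)) = x * expR (- k).
  rewrite mul1r opprD expRD [expR (- ln _)]expRN lnK ?posrE// mulrA; congr (_ * _).
  by rewrite invfM invrK mulrA divff// mul1r.
by congr (lam _); apply/seteqP; split => k /=; rewrite /S/= E.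
Qed.
End lebesgue_affine.

(** * Iterated integrals over R^n and expectations of functions of a random vector *)

Section iter_int_theory.
Context {R : realType}.
Local Notation lam := (@lebesgue_measure R).
Local Open Scope ereal_scope.

Lemma iter_int_ge0 n (g : n.-tuple R -> \bar R) : (forall v, 0 <= g v) -> 0 <= iter_int g.
Proof. by elim: n g => [|n IH] g g0 //=; apply: integral_ge0 => y _; exact: IH. Qed.

Lemma iter_int0 n : iter_int (fun _ : n.-tuple R => 0) = 0.
Proof. by elim: n => [|n IH] //=; apply: integral0_eq => y _; exact: IH. Qed.

Lemma measurable_fun_cons n d (T : measurableType d) (G : T * n.+1.-tuple R -> \bar R) :
  measurable_fun setT G ->
  measurable_fun setT (fun p : (T * R) * n.-tuple R => G (p.1.1, [tuple of p.1.2 :: p.2])).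
Proof.
move=> mG; apply: (measurableT_comp mG); apply: measurable_fun_pair.
  exact: measurableT_comp.
by apply: measurable_cons => //; exact: measurableT_comp.
Qed.

(** The parameter space [T] is arbitrary because the induction on [n] moves the outermost
    integration variable into the parameter, replacing [T] by [T * R]. *)
Lemma measurable_iter_int n d (T : measurableType d) (G : T * n.-tuple R -> \bar R) :
  measurable_fun setT G -> (forall p, 0 <= G p) ->
  measurable_fun setT (fun x => iter_int (fun v => G (x, v))).
Proof.
elim: n d T G => [|n IH] d T G mG G0 /=.
  by apply: (measurableT_comp mG); exact: measurable_fun_pair.
pose H (p : T * R) := iter_int (fun v => G (p.1, [tuple of p.2 :: v])).
have mH : measurable_fun setT H.
  exact: (IH _ _ (fun q => G (q.1.1, [tuple of q.1.2 :: q.2])) (measurable_fun_cons mG)).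
have H0 p : 0 <= H p by exact: iter_int_ge0.
exact: (@measurable_fun_fubini_tonelli_F _ _ _ _ _ lam H mH H0).
Qed.

Lemma measurable_iter_int_cons n (g : n.+1.-tuple R -> \bar R) :
  measurable_fun setT g -> (forall v, 0 <= g v) ->
  measurable_fun setT (fun y : R => iter_int (fun v : n.-tuple R => g [tuple of y :: v])).
Proof.
move=> mg g0.
apply: (measurable_iter_int (G := fun p : R * n.-tuple R => g [tuple of p.1 :: p.2])) => //.
by apply: (measurableT_comp mg); exact: measurable_cons.
Qed.

Lemma measurable_fun_consr n (g : n.+1.-tuple R -> \bar R) (y : R) :
  measurable_fun setT g -> measurable_fun setT (fun v : n.-tuple R => g [tuple of y :: v]).
Proof. by move=> mg; apply: (measurableT_comp mg); exact: measurable_cons. Qed.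

Lemma iter_intD n (f g : n.-tuple R -> \bar R) :
  measurable_fun setT f -> measurable_fun setT g ->
  (forall v, 0 <= f v) -> (forall v, 0 <= g v) ->
  iter_int (fun v => f v + g v) = iter_int f + iter_int g.
Proof.
elim: n f g => [|n IH] f g mf mg f0 g0 //=.
rewrite -ge0_integralD//; try exact: measurable_iter_int_cons;
  try (by move=> y _; exact: iter_int_ge0).
by apply: eq_integral => y _; rewrite IH//; exact: measurable_fun_consr.
Qed.

Lemma iter_intZ n (k : R) (f : n.-tuple R -> \bar R) : (0 <= k)%R ->
  measurable_fun setT f -> (forall v, 0 <= f v) ->
  iter_int (fun v => k%:E * f v) = k%:E * iter_int f.
Proof.
move=> k0; elim: n f => [|n IH] f mf f0 //=.
rewrite -ge0_integralZl_EFin//; try exact: measurable_iter_int_cons;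
  try (by move=> y _; exact: iter_int_ge0).
by apply: eq_integral => y _; rewrite IH//; exact: measurable_fun_consr.
Qed.

Lemma le_iter_int n (f g : n.-tuple R -> \bar R) :
  measurable_fun setT f -> measurable_fun setT g ->
  (forall v, 0 <= f v) -> (forall v, f v <= g v) -> iter_int f <= iter_int g.
Proof.
elim: n f g => [|n IH] f g mf mg f0 fg //=.
have g0 v : 0 <= g v by exact: le_trans (fg v).
apply: ge0_le_integral => //; try exact: measurable_iter_int_cons;
  try (by move=> y _; exact: iter_int_ge0).
by move=> y _; apply: IH => //; exact: measurable_fun_consr.
Qed.

Lemma iter_int_cvg n (f : (n.-tuple R -> \bar R)^nat) (g : n.-tuple R -> \bar R) :
  (forall k, measurable_fun setT (f k)) -> (forall k v, 0 <= f k v) ->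
  (forall v, {homo f ^~ v : k l / (k <= l)%N >-> k <= l}) ->
  (forall v, f ^~ v @ \oo --> g v) ->
  iter_int (f k) @[k --> \oo] --> iter_int g.
Proof.
elim: n f g => [|n IH] f g mf f0 ndf fg //=.
pose h k y := iter_int (fun v : n.-tuple R => f k [tuple of y :: v]).
have E y : limn (h^~ y) = iter_int (fun v : n.-tuple R => g [tuple of y :: v]).
  by apply/cvg_lim => //; apply: IH => // k; exact: measurable_fun_consr.
have -> : \int[lam]_y iter_int (fun v : n.-tuple R => g [tuple of y :: v]) =
    \int[lam]_y limn (h^~ y) by apply: eq_integral => y _; rewrite E.
apply: cvg_monotone_convergence => //.
- by move=> k; exact: measurable_iter_int_cons.
- by move=> k y _; exact: iter_int_ge0.
- move=> y _ k l kl; apply: le_iter_int => //; try exact: measurable_fun_consr.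
  by move=> v; exact: ndf.
Qed.

Lemma iter_int_sum n (I : Type) (s : seq I) (F : I -> n.-tuple R -> \bar R) :
  (forall i, measurable_fun setT (F i)) -> (forall i v, 0 <= F i v) ->
  iter_int (fun v => \sum_(i <- s) F i v) = \sum_(i <- s) iter_int (F i).
Proof.
move=> mF F0; elim: s => [|i s IH].
  rewrite big_nil -[RHS](iter_int0 n); congr iter_int.
  by apply/funext => v; rewrite big_nil.
rewrite big_cons -IH -iter_intD//; first last.
- by move=> v; exact: sume_ge0.
- exact: emeasurable_sum.
by congr iter_int; apply/funext => v; rewrite big_cons.
Qed.

Context {d : measure_display} {Omega : measurableType d} (P : probability Omega R).
Import HBNNSimple.

Lemma density_vec_nnsfun n (X : Omega -> n.-tuple R) (f : n.-tuple R -> R)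
    (h : {nnsfun (n.-tuple R) >-> R}) :
  is_density_vec P X f ->
  \int[P]_w (h (X w))%:E = iter_int (fun v => (h v * f v)%:E).
Proof.
move=> [mX [mf [f0 PX]]].
have mI A : measurable A -> measurable_fun setT (\1_A : n.-tuple R -> R).
  by move=> mA; exact: measurable_indic.
have mhr r : measurable (h @^-1` [set r]) by exact: measurable_sfunP.
pose s := finmap.enum_fset (fset_set (range h)).
have hE v : (h v)%:E = \sum_(r <- s) (r * \1_(h @^-1` [set r]) v)%:E.
  by rewrite fimfunE -fsumEFin// fsbig_finite.
have F0 r v : 0 <= (r * \1_(h @^-1` [set r]) v)%:E :> \bar R.
  by rewrite EFinM; exact: nnfun_muleindic_ge0.
under eq_integral do rewrite hE.
rewrite ge0_integral_sum//; last first.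
  move=> r; apply/measurable_EFinP; apply: measurable_funM => //.
  exact: (measurableT_comp (mI _ (mhr r)) mX).
transitivity (iter_int (fun v => \sum_(r <- s) (r * \1_(h @^-1` [set r]) v * f v)%:E)); last first.
  congr iter_int; apply/funext => v; rewrite EFinM hE ge0_sume_distrl//.
rewrite iter_int_sum//; last 2 first.
- move=> r; apply/measurable_EFinP; apply: measurable_funM => //.
  by apply: measurable_funM => //; exact: measurable_indic.
- by move=> r v; rewrite EFinM mule_ge0// ?lee_fin.
rewrite big_seq [RHS]big_seq; apply: eq_bigr => r; rewrite in_fset_set// inE/= => -[v0 _ <-].
set A := h @^-1` _.
have mA : measurable A by exact: mhr.
under eq_integral do rewrite EFinM.
rewrite ge0_integralZl_EFin//; last first.
  by apply/measurable_EFinP; exact: (measurableT_comp (mI _ mA) mX).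
transitivity ((h v0)%:E * P (X @^-1` A)).
  congr (_ * _); rewrite -[in RHS](setIT (X @^-1` A)) -integral_indic//.
  by rewrite -[X in measurable X]setTI; exact: mX.
rewrite PX// -iter_intZ//.
- by congr iter_int; apply/funext => v; rewrite -EFinM mulrA.
- by apply/measurable_EFinP; apply: measurable_funM => //; exact: measurable_indic.
- by move=> v; rewrite lee_fin mulr_ge0.
Qed.

(** The hypothesis gives probabilities of events as iterated integrals, not as integrals against a
    measure on tuples. The formula is thus extended from indicators to simple functions, and from
    these by monotone convergence on both sides. *)
Lemma expectation_density_vec n (X : Omega -> n.-tuple R) (f g : n.-tuple R -> R) :
  is_density_vec P X f -> measurable_fun setT g -> (forall v, 0 <= g v)%R ->
  \int[P]_w (g (X w))%:E = iter_int (fun v => (g v * f v)%:E).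
Proof.
move=> Xf mg g0; have [mX [mf [f0 _]]] := Xf.
have mEg : measurable_fun setT (EFin \o g) by exact/measurable_EFinP.
have Eg0 v : setT v -> 0 <= (EFin \o g) v by rewrite lee_fin.
pose h := nnsfun_approx measurableT mEg.
have hg v : (h k v)%:E @[k --> \oo] --> (g v)%:E by exact: (cvg_nnsfun_approx _ _ Eg0).
have ndh v : {homo (fun k => h k v) : k l / (k <= l)%N >-> (k <= l)%R}.
  by move=> k l kl; have /lefP := nd_nnsfun_approx measurableT mEg kl; exact.
have c1 : \int[P]_w (h k (X w))%:E @[k --> \oo] --> \int[P]_w (g (X w))%:E.
  have E w : limn (fun k => (h k (X w))%:E) = (g (X w))%:E by apply/cvg_lim => //; exact: hg.
  have -> : \int[P]_w (g (X w))%:E = \int[P]_w limn (fun k => (h k (X w))%:E).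
    by apply: eq_integral => w _; rewrite E.
  apply: cvg_monotone_convergence => //.
  - by move=> k; apply/measurable_EFinP; exact: measurableT_comp.
  - by move=> k w _; rewrite lee_fin.
  - by move=> w _ k l kl; rewrite lee_fin ndh.
have c2 : \int[P]_w (h k (X w))%:E @[k --> \oo] --> iter_int (fun v => (g v * f v)%:E).
  under eq_fun do rewrite (density_vec_nnsfun _ Xf).
  apply: iter_int_cvg.
  - by move=> k; apply/measurable_EFinP; exact: measurable_funM.
  - by move=> k v; rewrite lee_fin mulr_ge0.
  - by move=> v k l kl; rewrite lee_fin ler_wpM2r// ndh.
  - move=> v; under eq_fun do rewrite EFinM; rewrite EFinM.
    by apply: cvgeZr => //; exact: hg.
exact: cvg_unique c1 c2.
Qed.

(* Integrate first along a coordinate with nonzero coefficient. *)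
Lemma iter_int_affine_null n (b : R) (c : 'I_n -> R) (S : set R) (f : n.-tuple R -> \bar R) :
  measurable S -> lam S = 0 -> (exists i, c i != 0%R) ->
  measurable_fun setT f -> (forall v, 0 <= f v) ->
  (forall v, ~ S (b + \sum_(i < n) c i * tnth v i)%R -> f v = 0) ->
  iter_int f = 0.
Proof.
move=> mS S0; elim: n b c f => [|n IH] b c f [i ci] mf f0 fS; first by case: i ci.
move=> /=.
(* If a later coefficient is nonzero, [y] is frozen, its term joins the offset [b], and induction
   applies to every inner integral. Otherwise the affine form depends on [y] alone. *)
have [[j cj]|c0] := pselect (exists j : 'I_n, c (lift ord0 j) != 0%R).
  apply: integral0_eq => y _; apply: (IH (b + c ord0 * y)%R (fun j => c (lift ord0 j))).
  - by exists j.
  - exact: measurable_fun_consr.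
  - by [].
  move=> v Sv; apply: fS; rewrite big_ord_recl tnth0 addrA.
  by under eq_bigr do rewrite tnthS.
have {}c0 j : c (lift ord0 j) = 0%R.
  by apply/eqP; apply: contra_notT c0 => cj; exists j.
have {}ci : c ord0 != 0%R.
  by move: ci; have [j ->|->//] := unliftP ord0 i; rewrite c0 eqxx.
have mS' : measurable ((fun y => b + c ord0 * y)%R @^-1` S).
  by rewrite -[X in measurable X]setTI; exact: (measurable_affine b (c ord0)).
(* The values of [y] that the form sends into [S] are a null set and can be discarded; for the
   others the inner integrand is identically 0. *)
rewrite (@ge0_negligible_integral _ _ _ lam setT ((fun y => b + c ord0 * y)%R @^-1` S)) => //; first last.
- exact: (lebesgue_null_affine b ci mS S0).
- by move=> y _; exact: iter_int_ge0.
- exact: measurable_iter_int_cons.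
apply: integral0_eq => y [_ /= Sy]; rewrite -[RHS](iter_int0 n); congr iter_int.
apply/funext => v; apply: fS; rewrite big_ord_recl tnth0 big1 ?addr0// => j _.
by rewrite c0 mul0r.
Qed.
End iter_int_theory.

Lemma cvg_succn (V : ptopologicalType) (u : nat -> V) (l : V) :
  u n.+1 @[n --> \oo] --> l <-> u @ \oo --> l.
Proof. by have -> := cvg_shiftS u (nbhs l). Qed.

Lemma integral_sqr_le_Lnorm2 {R : realType} {d : measure_display} {T : measurableType d}
    (mu : {measure set T -> \bar R}) (f : T -> R) (C : R) :
  ('N[mu]_2%:E[(fun x => (f x)%:E)] <= C%:E)%E ->
  (\int[mu]_x (f x ^+ 2)%:E <= (C ^+ 2)%:E)%E.
Proof.
move=> NC; have C0 : 0 <= C by rewrite -lee_fin; exact: le_trans (Lnorm_ge0 _ _ _) NC.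
have -> : (\int[mu]_x (f x ^+ 2)%:E = 'N[mu]_2%:E[(fun x => (f x)%:E)] `^ 2)%E.
  rewrite poweR_Lnorm//; apply: eq_integral => x _.
  by rewrite /= powR_mulrn// real_normK// num_real.
have -> : ((C ^+ 2)%:E = C%:E `^ 2)%E by rewrite poweR_EFin powR_mulrn.
by apply: gt0_ler_poweR => //; rewrite in_itv/= ?leey ?Lnorm_ge0// lee_fin C0.
Qed.

(** * Passing to the limit in expectations under L1 convergence *)

Section L1_convergence.
Context {R : realType} {d : measure_display} {Omega : measurableType d}.
Context (P : probability Omega R).

(** The errors sum to a function of finite expectation, so almost surely the series of errors
    converges and its terms tend to 0. *)
Lemma ae_cvg_fast (Z : nat -> Omega -> R) (Y : Omega -> R) :
  (forall k, measurable_fun setT (Z k)) -> measurable_fun setT Y ->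
  (forall k, \int[P]_w `|Z k w - Y w|%:E <= (1 / (2 ^ k.+1)%:R)%:E)%E ->
  {ae P, forall w, Z k w @[k --> \oo] --> Y w}.
Proof.
move=> mZ mY ZY.
pose f k w := (`|Z k w - Y w|%:E : \bar R).
have mf k : measurable_fun setT (f k).
  by apply/measurable_EFinP; apply: measurableT_comp => //; exact: measurable_funB.
have f0 k w : (0 <= f k w)%E by rewrite lee_fin.
have fin : (\int[P]_w (\sum_(k <oo) f k w) < +oo)%E.
  rewrite integral_nneseries//.
  apply: (@le_lt_trans _ _ (\sum_(k <oo) (1 / (2 ^ k.+1)%:R)%:E)%E).
    apply: lee_nneseries => [k _ _|k _]; [exact: integral_ge0|exact: ZY].
  by apply: (le_lt_trans (epsilon_trick0 xpredT _)); rewrite ?ltry.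
have F0 w : (0 <= \sum_(k <oo) f k w)%E by exact: nneseries_ge0.
have : P.-integrable setT (fun w => \sum_(k <oo) f k w)%E.
  apply/integrableP; split; first exact: ge0_emeasurable_sum.
  by under eq_integral do rewrite gee0_abs//.
move=> /(integrable_ae measurableT); apply: filterS => w /(_ I) fw.
have /cvg_series_cvg_0 : cvgn (series (fun k => `|Z k w - Y w|)).
  by apply: nnseries_is_cvg => //; rewrite ltey_eq fw.
by move=> /norm_cvg0P; exact: (subr_cvg0 _ _).1.
Qed.

(** If [u] left a neighbourhood of [l] infinitely often, one could choose at each rate 2^-(k+1) an
    index where it does, contradicting the assumption. The chosen indices need not increase; only
    the L1 rate matters. *)
Lemma cvg_fast_subseq (V : topologicalType) (u : nat -> V) (l : V)
    (Y_ : nat -> Omega -> R) (Y : Omega -> R) :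
  (\int[P]_w `|Y_ n w - Y w|%:E)%E @[n --> \oo] --> 0%E ->
  (forall s : nat -> nat,
    (forall k, \int[P]_w `|Y_ (s k) w - Y w|%:E <= (1 / (2 ^ k.+1)%:R)%:E)%E ->
    u (s k) @[k --> \oo] --> l) ->
  u @ \oo --> l.
Proof.
move=> YY H A Al /=; apply: contrapT => nA.
have ex k : exists n, (\int[P]_w `|Y_ n w - Y w|%:E <= (1 / (2 ^ k.+1)%:R)%:E)%E /\ ~ A (u n).
  apply: contrapT => /forallNP K; apply: nA.
  have e0 : (0%E < (1 / (2 ^ k.+1)%:R)%:E :> \bar R)%E by rewrite lte_fin divr_gt0// ltr0n expn_gt0.
  have near_e : \forall n \near \oo,
      (\int[P]_w `|Y_ n w - Y w|%:E < (1 / (2 ^ k.+1)%:R)%:E)%E.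
    exact: YY _ (open_ereal_lt' e0).
  apply: filterS near_e => n /ltW en.
  by apply: contrapT => nAu; exact: (K n).
have [s hs] := choice ex.
have /(_ A Al) := H s (fun k => (hs k).1).
move=> [N _ /(_ N (leqnn N))]; exact: (hs N).2.
Qed.

(** The event [E] is carried along for the sake of independence: with [E] the event X in A, the
    integral records the joint law of X and the limit. *)
Lemma cvg_integral_bounded_continuous (E : set Omega) (Y_ : nat -> Omega -> R)
    (Y : Omega -> R) (h : R -> R) (B : R) :
  measurable E -> (forall n, measurable_fun setT (Y_ n)) -> measurable_fun setT Y ->
  (\int[P]_w `|Y_ n w - Y w|%:E)%E @[n --> \oo] --> 0%E ->
  continuous h -> (forall k, `|h k| <= B) ->
  (\int[P]_(w in E) (h (Y_ n w))%:E)%E @[n --> \oo] --> (\int[P]_(w in E) (h (Y w))%:E)%E.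
Proof.
move=> mE mY_ mY YY ch hB.
have mh : measurable_fun setT h by exact: continuous_measurable_fun.
apply: (cvg_fast_subseq YY) => s sfast.
have ae := ae_cvg_fast (fun k => mY_ (s k)) mY sfast.
have iB : P.-integrable E (cst B%:E) by exact: finite_measure_integrable_cst.
have [] // := @dominated_convergence _ _ _ P E mE (fun k w => (h (Y_ (s k) w))%:E)
  (fun w => (h (Y w))%:E) (cst B%:E) _ _ _ iB _.
- by move=> k; apply/measurable_EFinP; apply: measurable_funTS; exact: measurableT_comp.
- by apply/measurable_EFinP; apply: measurable_funTS; exact: measurableT_comp.
- apply: filterS ae => w cw _; apply: cvg_EFin; first exact: nearW.
  exact: (cvg_comp _ _ cw (ch _)).
- by apply: aeW => w k _; rewrite lee_fin.
Qed.

(* Cut g at height m M: wherever g exceeds it, expR (- k) > m, so the error is at most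
   (M / m) expR (- k) ^+ 2, which the second moment bound makes small uniformly in n. *)
Lemma cvg_integral_expRN_dominated (Y_ : nat -> Omega -> R) (Y : Omega -> R)
    (g : R -> R) (M C : R) :
  (forall n, measurable_fun setT (Y_ n)) -> measurable_fun setT Y ->
  (\int[P]_w `|Y_ n w - Y w|%:E)%E @[n --> \oo] --> 0%E ->
  (forall n, \int[P]_w (expR (- Y_ n w) ^+ 2)%:E <= C%:E)%E ->
  continuous g -> (forall k, 0 <= g k <= M * expR (- k)) ->
  (\int[P]_w (g (Y w))%:E < +oo)%E /\
  (\int[P]_w (g (Y_ n w))%:E)%E @[n --> \oo] --> (\int[P]_w (g (Y w))%:E)%E.
Proof.
move=> mY_ mY YY HC cg gM.
have mg : measurable_fun setT g by exact: continuous_measurable_fun.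
have g0 k : 0 <= g k by have /andP[] := gM k.
have M0 : 0 <= M by have := gM 0; rewrite oppr0 expR0 mulr1 => /andP[]; exact: le_trans.
have C0 : 0 <= C.
  by rewrite -lee_fin; apply: le_trans (HC 0%N); apply: integral_ge0 => w _; rewrite lee_fin sqr_ge0.
pose t (m : nat) k := Num.min (g k) (m%:R * M).
have ct m : continuous (t m).
  by move=> k; apply: (@continuous_min _ _ g (cst (m%:R * M))); [exact: cg|exact: cst_continuous].
have mt m : measurable_fun setT (t m) by exact: continuous_measurable_fun.
have t0 m k : 0 <= t m k by rewrite le_min g0 mulr_ge0.
have tM m k : `|t m k| <= m%:R * M by rewrite ger0_norm// ge_min lexx orbT.
have tg m k : t m k <= g k by rewrite ge_min lexx.
have gt (m : nat) k : (0 < m)%N -> g k <= t m k + M / m%:R * expR (- k) ^+ 2.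
  move=> m0; have mR : 0 < m%:R :> R by rewrite ltr0n.
  rewrite /t; case: (leP (g k) (m%:R * M)) => gk.
    by rewrite lerDl mulr_ge0 ?sqr_ge0// divr_ge0// ltW.
  have /andP[_ gk'] := gM k.
  have mk : m%:R <= expR (- k).
    move: gk gk'; rewrite le_eqVlt in M0; case/orP: M0 => [/eqP <-|M0].
      by rewrite mulr0 mul0r => /lt_le_trans/[apply]; rewrite ltxx.
    by move=> /lt_le_trans/[apply]; rewrite mulrC ltr_pM2l// => /ltW.
  apply: le_trans gk' _; apply: ler_wpDl; first by rewrite mulr_ge0.
  rewrite -mulrA; apply: ler_wpM2l => //; rewrite expr2 mulrA ler_peMl ?expR_ge0//.
  by rewrite mulrC ler_pdivlMr// mul1r.
have mc (Z : Omega -> R) (q : R -> R) : measurable_fun setT Z -> measurable_fun setT q ->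
    measurable_fun setT (fun w => (q (Z w))%:E).
  by move=> mZ mq; apply/measurable_EFinP; exact: measurableT_comp.
have m2 : measurable_fun setT (fun k : R => expR (- k) ^+ 2).
  by apply: measurable_funX; apply: measurableT_comp => //; exact: measurableT_comp.
pose I (q : R -> R) Z := (\int[P]_w (q (Z w))%:E)%E.
have I0 q Z : (forall k, 0 <= q k) -> (0 <= I q Z)%E.
  by move=> q0; apply: integral_ge0 => w _; rewrite lee_fin.
have Itm m Z : measurable_fun setT Z -> (I (t m) Z <= (m%:R * M)%:E)%E.
  move=> mZ; apply: (@le_trans _ _ (\int[P]_w (m%:R * M)%:E)%E).
    apply: ge0_le_integral => //; [by move=> w _; rewrite lee_fin|exact: mc|].
    by move=> w _; rewrite lee_fin -[t _ _]ger0_norm.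
  by rewrite integral_cst//= probability_setT mule1.
have Itg m Z : measurable_fun setT Z -> (I (t m) Z <= I g Z)%E.
  by move=> mZ; apply: ge0_le_integral => //;
    [by move=> w _; rewrite lee_fin|exact: mc|exact: mc|move=> w _; rewrite lee_fin].
have Igt m n : (0 < m)%N -> (I g (Y_ n) <= I (t m) (Y_ n) + (M / m%:R * C)%:E)%E.
  move=> m0; have Mm0 : 0 <= M / m%:R by rewrite divr_ge0.
  apply: (@le_trans _ _ (\int[P]_w ((t m (Y_ n w))%:E + (M / m%:R)%:E * (expR (- Y_ n w) ^+ 2)%:E))%E).
    apply: ge0_le_integral => //; first by move=> w _; rewrite lee_fin.
    - exact: mc.
    - by apply: emeasurable_funD; [exact: mc|apply: emeasurable_funM => //; exact: (mc _ _ _ m2)].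
    - by move=> w _; rewrite -EFinM -EFinD lee_fin gt.
  rewrite ge0_integralD//; last 4 first.
  - by move=> w _; rewrite lee_fin.
  - exact: mc.
  - by move=> w _; rewrite -EFinM lee_fin mulr_ge0// sqr_ge0.
  - by apply: emeasurable_funM => //; exact: (mc _ _ _ m2).
  rewrite ge0_integralZl_EFin //; last exact: (mc _ _ _ m2).
  by rewrite leeD2l// [(_ * C)%:E]EFinM lee_wpmul2l// lee_fin.
have ctm m : I (t m) (Y_ n) @[n --> \oo] --> I (t m) Y.
  exact: (cvg_integral_bounded_continuous measurableT mY_ mY YY (ct m) (tM m)).
have cm : I (t m) Y @[m --> \oo] --> I g Y.
  have lt w : limn (fun m => (t m (Y w))%:E) = (g (Y w))%:E.
    apply/cvg_lim => //; apply: cvg_near_cst.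
    (* At a fixed [w] the cut is inactive as soon as m >= e^(-Y w). *)
    near=> m; rewrite /t min_l//.
    have /andP[_ gk] := gM (Y w); apply: le_trans gk _; rewrite mulrC ler_wpM2r//.
    near: m; exact: nbhs_infty_ger.
  have -> : I g Y = (\int[P]_w limn (fun m => (t m (Y w))%:E))%E.
    by apply: eq_integral => w _; rewrite lt.
  apply: cvg_monotone_convergence => //.
  - by move=> m; exact: mc.
  - by move=> m w _; rewrite lee_fin.
  - move=> w _ m m' mm'; rewrite lee_fin /t le_min ge_min lexx/= ge_min.
    by apply/orP; right; rewrite ler_wpM2r// ler_nat.
(* This is the cut at m = 1: the part below contributes at most [M], the error at most [M * C].
   Being uniform in n and m, the bound passes first to the cut integrals at [Y] and then to [g]
   itself. *)
pose B := M + M * C.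
have IB n : (I g (Y_ n) <= B%:E)%E.
  apply: le_trans (Igt 1%N n isT) _; rewrite divr1 EFinD leeD2r//.
  by have := Itm 1%N (Y_ n) (mY_ n); rewrite mul1r.
have IBm m : (I (t m) Y <= B%:E)%E.
  apply: (cvge_le _ (ctm m)); apply: nearW => n.
  exact: le_trans (Itg m _ (mY_ n)) (IB n).
have IBY : (I g Y <= B%:E)%E by apply: (cvge_le _ cm); exact: nearW.
split; first exact: le_lt_trans IBY (ltry _).
have fin Q : (0 <= Q)%E -> (Q <= B%:E)%E -> Q \is a fin_num.
  by move=> Q0 QB; rewrite ge0_fin_numE//; exact: le_lt_trans QB (ltry _).
have Yfin : I g Y \is a fin_num by exact: fin (I0 _ _ g0) IBY.
have tfin m : I (t m) Y \is a fin_num by exact: fin (I0 _ _ (t0 m)) (IBm m).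
have gnfin n : I g (Y_ n) \is a fin_num by exact: fin (I0 _ _ g0) (IB n).
have tnfin m n : I (t m) (Y_ n) \is a fin_num.
  by apply: fin (I0 _ _ (t0 m)) (le_trans (Itg _ _ (mY_ n)) (IB n)).
rewrite -/(I g Y) -(fineK Yfin); apply: cvg_EFin; first exact: nearW.
apply/cvgrPdist_le => e e0; have e20 : 0 < e / 2 by exact: divr_gt0.
(* The cut is fixed before n: both errors it causes, at [Y] and at all [Y_ n] simultaneously, are
   then at most e / 2. *)
have [m [m0 bm Cm]] : exists m : nat, [/\ (0 < m)%N,
    `|fine (I g Y) - fine (I (t m) Y)| <= e / 2 & M / m%:R * C <= e / 2].
  have h1 : \forall m \near \oo, `|fine (I g Y) - fine (I (t m) Y)| <= e / 2.
    by apply: cvgr_dist_le => //; apply: fine_cvg; rewrite fineK.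
  have h2 : \forall m \near \oo, (0 < m)%N by exact: nbhs_infty_gt.
  have h3 : \forall m \near \oo, M * C / (e / 2) <= m%:R by exact: nbhs_infty_ger.
  have [m _ /(_ m (leqnn m)) [/= [{}h1 {}h2] {}h3]] := filterI (filterI h1 h2) h3.
  exists m; split => //.
  have mR : 0 < m%:R :> R by rewrite ltr0n.
  by rewrite mulrAC (ler_pdivrMr _ _ mR) [leRHS]mulrC -(ler_pdivrMr _ _ e20).
have h : \forall n \near \oo, `|fine (I (t m) Y) - fine (I (t m) (Y_ n))| <= e / 2.
  by apply: cvgr_dist_le => //; apply: fine_cvg; rewrite fineK.
apply: filterS h => n hn.
have l1 : fine (I (t m) (Y_ n)) <= fine (I g (Y_ n)) by rewrite fine_le// Itg.
have l2 : fine (I g (Y_ n)) <= fine (I (t m) (Y_ n)) + M / m%:R * C.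
  by rewrite -lee_fin EFinD !fineK// Igt.
have l3 : fine (I (t m) Y) <= fine (I g Y) by rewrite fine_le// Itg.
move: hn bm; rewrite /= !ler_norml => /andP[h1 h2] /andP[h3 h4].
by rewrite /= -/(I g (Y_ n)); apply/andP; split; lra.
Unshelve. all: by end_near.
Qed.
End L1_convergence.

(** * Independence, its stability under L1 limits, and the law of a scaled variable *)

Section independence.
Context {R : realType} {d : measure_display} {Omega : measurableType d}.
Context (P : probability Omega R).
Local Notation lam := (@lebesgue_measure R).
Local Open Scope ereal_scope.

Definition indep_rv (X Y : Omega -> R) : Prop :=
  forall A B : set R, measurable A -> measurable B ->
    P (X @^-1` A `&` Y @^-1` B) = P (X @^-1` A) * P (Y @^-1` B).

(** Independence says that the joint law agrees with the product of the marginals on rectangles,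
    hence everywhere; the rest is Tonelli. *)
Lemma integral_indep (X Y : Omega -> R) (F : R * R -> \bar R) :
  measurable_fun setT X -> measurable_fun setT Y -> indep_rv X Y ->
  measurable_fun setT F -> (forall p, 0 <= F p) ->
  \int[P]_w F (X w, Y w) = \int[P]_w' \int[P]_w F (X w, Y w').
Proof.
move=> mX mY XY mF F0.
have mXY : measurable_fun setT (fun w => (X w, Y w)) by exact: measurable_fun_pair.
pose X' : {mfun Omega >-> R} := HB.pack X (@isMeasurableFun.Build _ _ _ _ X mX).
pose Y' : {mfun Omega >-> R} := HB.pack Y (@isMeasurableFun.Build _ _ _ _ Y mY).
pose XY' : {mfun Omega >-> (R * R)%type} :=
  HB.pack (fun w => (X w, Y w)) (@isMeasurableFun.Build _ _ _ _ _ mXY).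
rewrite -[LHS](@ge0_integral_distribution _ _ _ _ _ P XY' F)//.
rewrite (@eq_measure_integral _ _ _ _ (distribution P X' \x distribution P Y')); last first.
  by move=> A mA _; apply/esym; exact: product_measure_unique.
rewrite fubini_tonelli2// (@ge0_integral_distribution _ _ _ _ _ P Y')//; last 2 first.
- exact: measurable_fun_fubini_tonelli_G.
- by move=> y; apply: integral_ge0.
apply: eq_integral => w _ /=; rewrite /fubini_G.
rewrite (@ge0_integral_distribution _ _ _ _ _ P X')//.
exact: measurable_fun_pair1.
Qed.

(** The product formula survives the limit for continuous functions of [Y]. Approximating indicators
    gives it on open rays, and these form a generating family stable under intersection. *)
Lemma indep_rv_L1_limit (X : Omega -> R) (Y_ : nat -> Omega -> R) (Y : Omega -> R) :
  measurable_fun setT X -> (forall n, measurable_fun setT (Y_ n)) -> measurable_fun setT Y ->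
  \int[P]_w `|Y_ n w - Y w|%:E @[n --> \oo] --> 0 ->
  (forall n, indep_rv X (Y_ n)) -> indep_rv X Y.
Proof.
move=> mX mY_ mY YY ind A B mA mB.
pose E := X @^-1` A.
have mE : measurable E by rewrite -[E]setTI; exact: mX.
have cont (h : R -> R) : continuous h -> (forall k, 0 <= h k <= 1)%R ->
    \int[P]_(w in E) (h (Y w))%:E = P E * \int[P]_w (h (Y w))%:E.
  move=> ch h01.
  have mh : measurable_fun setT h by exact: continuous_measurable_fun.
  have hB k : (`|h k| <= 1)%R by have /andP[h0 h1] := h01 k; rewrite ger0_norm.
  have h0 k : (0 <= h k)%R by have /andP[] := h01 k.
  have eqn n : \int[P]_(w in E) (h (Y_ n w))%:E = P E * \int[P]_w (h (Y_ n w))%:E.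
    pose F (p : R * R) := (\1_A p.1 * h p.2)%:E.
    have mF : measurable_fun setT F.
      apply/measurable_EFinP; apply: measurable_funM; last exact: measurableT_comp.
      by apply: measurableT_comp => //; exact: measurable_indic.
    have F0 p : 0 <= F p by rewrite lee_fin mulr_ge0.
    have := integral_indep mX (mY_ n) (ind n) mF F0; rewrite /F/= => H.
    rewrite integral_mkcond; transitivity (\int[P]_w (\1_A (X w) * h (Y_ n w))%:E).
      apply: eq_integral => w _; rewrite patchE indicE (_ : (w \in E) = (X w \in A))//.
      by case: ifPn; rewrite ?mul1r ?mul0r.
    rewrite H; rewrite -ge0_integralZl//; last 2 first.
    - by apply/measurable_EFinP; exact: measurableT_comp.
    - by move=> w _; rewrite lee_fin.
    apply: eq_integral => w _.
    under eq_integral do rewrite EFinM.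
    rewrite ge0_integralZr ?lee_fin//; last first.
      by apply/measurable_EFinP; apply: measurableT_comp => //; exact: measurable_indic.
    by congr (_ * _); rewrite -[in RHS](setIT E) -integral_indic.
  have c1 := cvg_integral_bounded_continuous mE mY_ mY YY ch hB.
  have c2 := cvg_integral_bounded_continuous measurableT mY_ mY YY ch hB.
  have c3 : \int[P]_(w in E) (h (Y_ n w))%:E @[n --> \oo] --> P E * \int[P]_w (h (Y w))%:E.
    under eq_fun do rewrite eqn.
    by apply: cvgeZl => //; exact: fin_num_measure.
  exact: cvg_unique c1 c3.
have ray b : P (Y @^-1` `]-oo, b[ `&` E) = P E * P (Y @^-1` `]-oo, b[).
  (* Continuous ramps that vanish for k >= b and equal 1 once b - k >= 1 / m; at each point they are
     eventually equal to the indicator of the open ray. *)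
  pose h (m : nat) (k : R) := Num.min 1%R (m%:R * Num.max 0 (b - k))%R.
  have h01 m k : (0 <= h m k <= 1)%R.
    by rewrite le_min ler01 ge_min lexx andbT/= mulr_ge0// le_max lexx.
  have hE m k : (`|h m k| <= 1)%R by have /andP[h0 h1] := h01 m k; rewrite ger0_norm.
  have ch m : continuous (h m).
    move=> k; apply: (@continuous_min _ _ (cst 1%R) (fun k => m%:R * Num.max 0 (b - k))%R).
      exact: cst_continuous.
    apply: (@continuousM _ _ (cst m%:R) (fun k => Num.max 0 (b - k))%R); first exact: cst_continuous.
    apply: (@continuous_max _ _ (cst 0%R) (fun k => (b - k))%R); first exact: cst_continuous.
    by apply: continuousB; [exact: cst_continuous|exact: cvg_id].
  have mh m : measurable_fun setT (h m) by exact: continuous_measurable_fun.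
  have cvgh k : (h m k)%:E @[m --> \oo] --> (\1_(`]-oo, b[%classic) k : R)%:E.
    apply: cvg_near_cst; rewrite indicE /h; have [kb|bk] := ltP k b.
      rewrite mem_set/=; last by rewrite in_itv.
      have bk0 : (0 < b - k)%R by rewrite subr_gt0.
      near=> m; rewrite max_r ?ltW// min_l// -ler_pdivrMr// mul1r.
      by near: m; exact: nbhs_infty_ger.
    rewrite memNset/=; last by rewrite in_itv/=; apply/negP; rewrite -leNgt.
    by near=> m; rewrite max_l ?subr_le0// mulr0 min_r.
  have lim D : measurable D -> \int[P]_(w in D) (h m (Y w))%:E @[m --> \oo] -->
      P (Y @^-1` `]-oo, b[ `&` D).
    move=> mD.
    have mYb : measurable (Y @^-1` `]-oo, b[) by rewrite -[X in measurable X]setTI; exact: mY.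
    rewrite -integral_indic//.
    apply: (@dominated_cvg _ _ _ P D mD (fun m w => (h m (Y w))%:E) _ (cst 1)) => //.
    - by move=> m; apply/measurable_EFinP; apply: measurable_funTS; exact: measurableT_comp.
    - exact: (@finite_measure_integrable_cst _ _ _ P D 1%R mD).
    - by move=> m w _; rewrite lee_fin.
  have c1 := lim E mE.
  have c2 : P E * \int[P]_w (h m (Y w))%:E @[m --> \oo] --> P E * P (Y @^-1` `]-oo, b[).
    apply: cvgeZl; first exact: fin_num_measure.
    by have := lim setT measurableT; rewrite setIT.
  have c3 : \int[P]_(w in E) (h m (Y w))%:E @[m --> \oo] --> P E * P (Y @^-1` `]-oo, b[).
    by under eq_fun do rewrite (cont (h _))//.
  exact: cvg_unique c1 c3.
have fE : (0 <= fine (P E))%R by exact: fine_ge0.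
have EE : (fine (P E))%:E = P E by rewrite fineK// fin_num_measure.
pose G := @RGenInftyO.G R.
have GE : measurable = <<s G >> by exact: RGenInftyO.measurableE.
have GI : setI_closed G.
  move=> _ _ [x ->] [y ->]; exists (Num.min x y); apply/seteqP; split => z /=;
    rewrite !in_itv/= lt_min; first by move=> [-> ->].
  by move=> /andP.
have Gn n : G `]-oo, n%:R[%classic by exists n%:R.
have GU : \bigcup_(n : nat) `]-oo, n%:R[%classic = [set: R].
  apply/seteqP; split => // x _; exists (Num.truncn x).+1 => //=; rewrite in_itv/=.
  have [x0|x0] := leP 0%R x; first by have /andP[] := truncn_itv x0.
  by apply: (lt_le_trans x0); rewrite ler0n.
have mYk (k : R) : measurable (Y @^-1` `]-oo, k[).
  by rewrite -[X in measurable X]setTI; exact: mY.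
pose Y' : {mfun Omega >-> R} := HB.pack Y (@isMeasurableFun.Build _ _ _ _ Y mY).
(* The finite measures compared are B -> P(E) P(Y in B) and B -> P(E and Y in B); the rays ending at
   natural numbers exhaust the line. *)
have := @measure_unique _ R R G (fun n => `]-oo, n%:R[%classic) GE GI Gn GU (mscale (NngNum fE) (distribution P Y'))
  (pushforward (mrestr P mE) Y).
move=> /(_ mY _ _ B mB); rewrite /= /mscale/= /distribution /pushforward /mrestr EE => H.
rewrite setIC -H//.
- by move=> _ [b ->]; rewrite ray.
- move=> k; rewrite lte_mul_pinfty//; first exact: fin_num_measure.
  by rewrite -ge0_fin_numE// fin_num_measure.
Unshelve. all: by end_near.
Qed.

(** For a fixed value y of [Y], the variable X e^y has density x -> f(x e^-y) e^-y. Independence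
    allows averaging this over [Y], and Tonelli exchanges the two integrals. *)
Lemma scaled_density_law (X Y : Omega -> R) (f : R -> R) (A : set R) :
  is_density P X f -> measurable_fun setT Y -> indep_rv X Y -> measurable A ->
  P ((fun w => X w * expR (Y w))%R @^-1` A) =
  \int[lam]_(x in A) \int[P]_w (f (x * expR (- Y w)) * expR (- Y w))%:E.
Proof.
move=> [mX [mf [f0 PX]]] mY XY mA.
have mI : measurable_fun setT (\1_A : R -> R) by exact: measurable_indic.
have mXe : measurable_fun setT (fun p : R * R => p.1 * expR p.2)%R.
  by apply: measurable_funM => //; exact: measurableT_comp.
pose F (p : R * R) := (\1_A (p.1 * expR p.2) : R)%:E.
have mF : measurable_fun setT F by apply/measurable_EFinP; exact: (measurableT_comp mI mXe).
have F0 p : 0 <= F p by rewrite lee_fin.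
have mXY : measurable_fun setT (fun w => X w * expR (Y w))%R.
  by apply: measurable_funM => //; exact: measurableT_comp.
have -> : P ((fun w => X w * expR (Y w))%R @^-1` A) = \int[P]_w F (X w, Y w).
  rewrite -[in LHS](setIT (_ @^-1` A)) -integral_indic//.
  by rewrite -[X in measurable X]setTI; exact: mXY.
rewrite integral_indep//.
pose G (p : R * Omega) := (\1_A p.1 * (f (p.1 * expR (- Y p.2)) * expR (- Y p.2)))%:E.
have mE : measurable_fun setT (fun p : R * Omega => expR (- Y p.2)).
  by apply: measurableT_comp => //; apply: measurableT_comp => //; exact: measurableT_comp.
have mG : measurable_fun setT G.
  apply/measurable_EFinP; apply: measurable_funM; first exact: measurableT_comp.
  apply: measurable_funM => //; apply: measurableT_comp => //.
  exact: measurable_funM.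
have G0 p : 0 <= G p by rewrite lee_fin !mulr_ge0// expR_ge0.
transitivity (\int[P]_w \int[lam]_x G (x, w)); last first.
  rewrite -[LHS](@fubini_tonelli _ _ _ _ _ lam P G mG G0).
  rewrite [RHS]integral_mkcond; apply: eq_integral => x _; rewrite patchE /G/=.
  rewrite indicE; case: ifPn => xA.
    by apply: eq_integral => w _; rewrite mul1r.
  by apply: integral0_eq => w _; rewrite mul0r.
apply: eq_integral => w _.
have mA' : measurable [set y | A (y * expR (Y w))%R].
  rewrite -[X in measurable X]setTI; apply: (_ : measurable_fun setT _) => //.
  exact: measurable_funM.
transitivity (P (X @^-1` [set y | A (y * expR (Y w))%R])).
  rewrite -[in RHS](setIT (_ @^-1` _)) -integral_indic//.
  by rewrite -[X in measurable X]setTI; exact: mX.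
(* The substitution y = x e^(-Y w) turns the domain back into [A] and produces the factor e^(-Y
   w). *)
rewrite PX// (@ge0_integral_scale _ (expR (- Y w)))// ?expR_gt0//; last exact/measurable_EFinP.
have -> : [set x | [set y | A (y * expR (Y w))%R] (x * expR (- Y w))%R] = A.
  by apply/seteqP; split => x /=; rewrite -mulrA -expRD addNr expR0 mulr1.
rewrite integral_mkcond; apply: eq_integral => x _; rewrite patchE /G/= indicE.
by case: ifPn; rewrite ?mul1r ?mul0r.
Qed.
End independence.

(** * Time integrals of the paths of a square integrable process *)

Section sections_of_square_integrable.
Context {R : realType} {d : measure_display} {Omega : measurableType d}.
Context (P : probability Omega R).
Local Notation lam := (@lebesgue_measure R).
Local Open Scope ereal_scope.

(** From |f| <= 1 + f^2 on a set of finite measure. *)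
Lemma square_integrable (d' : measure_display) (T : measurableType d')
    (mu : {measure set T -> \bar R}) (D : set T) (f : T -> R) :
  measurable D -> mu D < +oo -> measurable_fun D f ->
  \int[mu]_(x in D) (f x ^+ 2)%:E < +oo -> mu.-integrable D (EFin \o f).
Proof.
move=> mD Dfin mf f2; apply/integrableP; split; first exact/measurable_EFinP.
apply: (@le_lt_trans _ _ (\int[mu]_(x in D) (1 + (f x ^+ 2)%:E))).
  apply: ge0_le_integral => //.
  - by apply: measurableT_comp => //; exact/measurable_EFinP.
  - apply: emeasurable_funD => //; apply/measurable_EFinP.
    by apply: measurable_funX.
  - move=> x _; rewrite -EFinD lee_fin.
    have [f1|f1] := leP `|f x|%R 1%R; first by apply: ler_wpDr => //; exact: sqr_ge0.
    by apply: ler_wpDl => //; rewrite -[leRHS]real_normK ?num_real// expr2 ler_peMl// ltW.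
rewrite ge0_integralD//; last first.
- by apply/measurable_EFinP; exact: measurable_funX.
- by move=> x _; rewrite lee_fin sqr_ge0.
by rewrite integral_cst// mul1e lte_add_pinfty.
Qed.

Lemma lebesgue_prod_lty (J : set R) : measurable J -> lam J < +oo ->
  (lam \x P) (J `*` [set: Omega]) < +oo.
Proof.
by move=> mJ Jfin; rewrite product_measure1E//= probability_setT mule1.
Qed.

Lemma measurable_fun_fst_on (J : set R) (f : R -> R) : measurable J ->
  measurable_fun J f ->
  measurable_fun (J `*` [set: Omega]) (fun p : R * Omega => f p.1).
Proof.
move=> mJ mf; apply: (@measurable_comp _ _ _ _ _ _ J) => //.
  by move=> _ [[s w] [Js _] <-].
exact: measurable_funTS.
Qed.

Context (J : set R) (b : R * Omega -> R).
Context (mJ : measurable J).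
Context (Jfin : lam J < +oo).
Context (mb : measurable_fun (J `*` [set: Omega]) b).
Context (b2 : \int[lam \x P]_(p in J `*` [set: Omega]) (b p ^+ 2)%:E < +oo).

(** Extension by zero, so that Fubini can be applied on the whole product space. *)
Let B := (EFin \o b) \_ (J `*` [set: Omega]).

Let patchG w : (fun s => B (s, w)) = (fun s => (b (s, w))%:E) \_ J.
Proof.
apply/funext => s; rewrite /B !patchE.
by rewrite (_ : ((s, w) \in J `*` [set: Omega]) = (s \in J))//;
  apply/idP/idP; rewrite !inE => //= -[].
Qed.

Let intB : (lam \x P).-integrable setT B.
Proof.
have mJO : measurable (J `*` [set: Omega]) by exact: measurableX.
rewrite /B -integrable_mkcond//; apply: square_integrable => //.
exact: lebesgue_prod_lty.
Qed.

Lemma ae_integrable_section : {ae P, forall w, lam.-integrable J (fun s => (b (s, w))%:E)}.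
Proof.
have := ae_integrable2 intB; apply: filterS => w.
by rewrite patchG -integrable_mkcond.
Qed.

Lemma measurable_Rintegral_section :
  measurable_fun setT (fun w => Rintegral lam J (fun s => b (s, w))).
Proof.
have -> : (fun w => Rintegral lam J (fun s => b (s, w))) =
    fine \o (fubini_G lam B).
  apply/funext => w; rewrite /Rintegral /= /fubini_G; congr fine.
  by rewrite [LHS]integral_mkcond; apply: eq_integral => s _; rewrite -[RHS]/((fun s => B (s, w)) s) patchG.
by apply: measurableT_comp => //; exact: (measurable_fubini_G intB).
Qed.

(** For b = a this is integrability of [mean_fun], without which the integral defining [K_a] could
    not be split into its terms. *)
Lemma integrable_Rintegral_section :
  lam.-integrable J (fun s => (Rintegral P setT (fun w => b (s, w)))%:E).
Proof.
have /integrable_fubini_F iF := intB.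
have mF := measurable_int _ iF.
have : lam.-integrable J (EFin \o (fine \o fubini_F P B)).
  apply: (@le_integrable _ _ _ lam J mJ _ (fubini_F P B)); last first.
  - exact: integrableS iF.
  - by move=> s _ /=; case: (fubini_F P B s) => [r| |] //=; rewrite leey.
  by apply: measurable_funTS; apply/measurable_EFinP; exact: measurableT_comp.
apply: eq_integrable => // s sJ /=; rewrite /Rintegral /fubini_F.
congr ((fine _)%:E); apply: eq_integral => w _; rewrite /B patchE mem_set//.
by split=> //; rewrite inE in sJ.
Qed.

Let mabs : measurable_fun setT (abse \o B).
Proof. by apply: measurableT_comp => //; exact: measurable_int intB. Qed.

Let absG : (fun w => \int[lam]_(s in J) `|b (s, w)|%:E) = fubini_G lam (abse \o B).
Proof.
apply/funext => w; rewrite /fubini_G [LHS]integral_mkcond; apply: eq_integral => s _.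
rewrite /= (_ : B (s, w) = ((fun s => (b (s, w))%:E) \_ J) s); last by rewrite -patchG.
by rewrite !patchE; case: ifPn => //=; rewrite normr0.
Qed.

Lemma measurable_integral_section :
  measurable_fun setT (fun w => \int[lam]_(s in J) `|b (s, w)|%:E).
Proof.
rewrite absG; apply: measurable_fun_fubini_tonelli_G => // p; exact: abse_ge0.
Qed.

(* From |b| <= e + b^2 / e. *)
Lemma integral_section_le (e : R) : (0 < e)%R ->
  \int[P]_w \int[lam]_(s in J) `|b (s, w)|%:E <=
  e%:E * lam J + e^-1%:E * \int[lam \x P]_(p in J `*` [set: Omega]) (b p ^+ 2)%:E.
Proof.
move=> e0; have mJO : measurable (J `*` [set: Omega]) by exact: measurableX.
rewrite absG.
rewrite -fubini_tonelli2//; last by move=> p; exact: abse_ge0.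
have -> : \int[lam \x P]_z (abse \o B) z = \int[lam \x P]_(p in J `*` [set: Omega]) `|b p|%:E.
  rewrite [RHS]integral_mkcond; apply: eq_integral => p _ /=; rewrite /B !patchE.
  by case: ifPn => //=; rewrite normr0.
have m2 : measurable_fun (J `*` [set: Omega]) (fun p => (b p ^+ 2)%:E).
  by apply/measurable_EFinP; exact: measurable_funX.
apply: (@le_trans _ _ (\int[lam \x P]_(p in J `*` [set: Omega])
   (e%:E + e^-1%:E * (b p ^+ 2)%:E))).
  apply: ge0_le_integral => //.
  - by apply/measurable_EFinP; exact: measurableT_comp.
  - by apply: emeasurable_funD => //; exact: emeasurable_funM.
  - move=> p _; rewrite -EFinM -EFinD lee_fin.
    have [f1|f1] := leP `|b p|%R e.
      by apply: ler_wpDr => //; rewrite mulr_ge0 ?sqr_ge0// invr_ge0 ltW.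
    apply: ler_wpDl; first exact: ltW.
    by rewrite -(@real_normK _ (b p)) ?num_real// expr2 mulrA ler_peMl// mulrC ler_pdivlMr// mul1r ltW.
rewrite ge0_integralD//; last 3 first.
- by move=> p _; rewrite lee_fin ltW.
- by move=> p _; rewrite -EFinM lee_fin mulr_ge0 ?sqr_ge0// invr_ge0 ltW.
- exact: emeasurable_funM.
rewrite integral_cst//= product_measure1E//= probability_setT mule1 leeD2l//.
rewrite ge0_integralZl_EFin//; first by move=> p _; rewrite lee_fin sqr_ge0.
by rewrite invr_ge0 ltW.
Qed.
End sections_of_square_integrable.

Lemma cvge0_ge0 {R : realType} (u : nat -> \bar R) : (forall n, 0 <= u n)%E ->
  (forall e : R, 0 < e -> \forall n \near \oo, (u n <= e%:E)%E) -> u @ \oo --> 0%E.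
Proof.
move=> u0 ue; apply: cvg_EFin.
  have := ue 1 ltr01; apply: filterS => n un.
  by rewrite ge0_fin_numE//; exact: le_lt_trans un (ltry _).
apply/cvgr0Pnorm_le => e e0; have := ue e e0; apply: filterS => n un.
have ufin : u n \is a fin_num by rewrite ge0_fin_numE//; exact: le_lt_trans un (ltry _).
by rewrite /= ger0_norm ?fine_ge0// -lee_fin fineK.
Qed.

(** * The truncated exponents and their L1 limit *)

Section truncated_exponent.
Context {R : realType} {d : measure_display} {Omega : measurableType d}.
Context (P : probability Omega R) (t0 T : R) (a : R -> Omega -> R) (nu : nat -> R).
Context (phi : nat -> R -> R) (xi : nat -> Omega -> R).
Local Notation lam := (@lebesgue_measure R).

Lemma Rintegral_sum (d' : measure_display) (U : measurableType d')
    (mu : {measure set U -> \bar R}) (D : set U) (I : Type) (s : seq I) (f : I -> U -> R) :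
  measurable D -> (forall i, mu.-integrable D (EFin \o f i)) ->
  mu.-integrable D (EFin \o (fun x => \sum_(i <- s) f i x)) /\
  Rintegral mu D (fun x => \sum_(i <- s) f i x) = \sum_(i <- s) Rintegral mu D (f i).
Proof.
move=> mD intf; elim: s => [|i s [IH1 IH2]].
  rewrite big_nil; under eq_fun do rewrite big_nil; split; first exact: integrable0.
  by rewrite /Rintegral integral0.
have E : (fun x => \sum_(j <- i :: s) f j x) = (fun x => f i x + \sum_(j <- s) f j x).
  by apply/funext => x; rewrite big_cons.
rewrite E big_cons -IH2; split; last exact: RintegralD.
by have := integrableD mD (intf i) IH1; exact: eq_integrable.
Qed.

Local Notation J := (`[t0, T]%classic : set R).

Context (mphi : forall j, measurable_fun J (phi j)).
Context (phi2 : forall j, (\int[lam]_(s in J) (phi j s ^+ 2)%:E < +oo)%E).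
Context (ma : measurable_fun (J `*` [set: Omega]) (fun p : R * Omega => a p.1 p.2)).
Context (a2 : (\int[(lam \x P)%E]_(p in J `*` [set: Omega]) (a p.1 p.2 ^+ 2)%:E < +oo)%E).

Let mJ : measurable J. Proof. exact: measurable_itv. Qed.

Let Jfin : (lam J < +oo)%E.
Proof. by rewrite /= lebesgue_measure_itv/=; case: ifP => // _; rewrite -EFinD ltry. Qed.

Let intphi j : lam.-integrable J (EFin \o phi j).
Proof. exact: (@square_integrable R _ (measurableTypeR R) lam J (phi j) mJ Jfin (mphi j) (phi2 j)). Qed.

Let intmean : lam.-integrable J (EFin \o mean_fun P a).
Proof. exact: (integrable_Rintegral_section mJ Jfin ma a2). Qed.

Let subJ t : t0 <= t <= T -> `[t0, t] `<=` J.
Proof.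
move=> /andP[_ tT] s /=; rewrite !in_itv/= => /andP[-> st].
exact: le_trans st tT.
Qed.

Let integrableI t (f : R -> \bar R) : t0 <= t <= T ->
  lam.-integrable J f -> lam.-integrable `[t0, t] f.
Proof. by move=> tT; apply: integrableS => //; exact: subJ. Qed.

Let trunc n s (v : n.-tuple R) :=
  mean_fun P a s + \sum_(j < n) Num.sqrt (nu j) * phi j s * tnth v j.

Let integrable_trunc n (v : n.-tuple R) (D : set R) : measurable D -> D `<=` J ->
  lam.-integrable D (EFin \o (fun s => trunc s v)) /\
  Rintegral lam D (fun s => trunc s v) = Rintegral lam D (mean_fun P a) +
    \sum_(j < n) Num.sqrt (nu j) * Rintegral lam D (phi j) * tnth v j.
Proof.
move=> mD DJ; have mD' : @measurable _ (measurableTypeR R) D by exact: mD.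
have im : lam.-integrable D (EFin \o mean_fun P a) by exact: integrableS intmean.
have ip j : lam.-integrable D (EFin \o phi j) by exact: integrableS (intphi j).
have ip' (j : 'I_n) : lam.-integrable D (EFin \o (fun s => Num.sqrt (nu j) * phi j s * tnth v j)).
  have := @integrableZl _ _ _ lam D mD (Num.sqrt (nu j) * tnth v j) _ (ip j).
  by apply: eq_integrable => // s _ /=; rewrite -EFinM mulrAC.
have [i1 e1] := @Rintegral_sum _ (measurableTypeR R) lam D _ (index_enum 'I_n)
  (fun j s => Num.sqrt (nu j) * phi j s * tnth v j) mD ip'.
split.
  by have := integrableD mD' im i1; exact: eq_integrable.
rewrite /trunc RintegralD// e1; congr (_ + _); apply: eq_bigr => j _.
transitivity (Rintegral lam D (fun s => Num.sqrt (nu j) * tnth v j * phi j s)).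
  by apply: eq_Rintegral => s _; rewrite mulrAC.
by rewrite RintegralZl// mulrAC.
Qed.

(** The exponent is an affine form in [v]. This yields its measurability, and later allows null sets
    of exponents to be discarded as soon as one coefficient is nonzero. *)
Lemma K_aE t n (v : n.-tuple R) : t0 <= t <= T ->
  K_a P t0 a nu phi t v = Rintegral lam `[t0, t] (mean_fun P a) +
    \sum_(j < n) Num.sqrt (nu j) * Rintegral lam `[t0, t] (phi j) * tnth v j.
Proof. by move=> tT; have [] := integrable_trunc v (measurable_itv _) (subJ tT). Qed.

Lemma measurable_K_a t n : t0 <= t <= T ->
  measurable_fun setT (fun v : n.-tuple R => K_a P t0 a nu phi t v).
Proof.
move=> tT; under eq_fun do rewrite K_aE//.
apply: measurable_funD => //; apply: measurable_sum => j.
by apply: measurable_funM => //; exact: measurable_tnth.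
Qed.

Lemma measurable_exponent t : t0 <= t <= T ->
  measurable_fun setT (fun w => Rintegral lam `[t0, t] (fun s => a s w)).
Proof.
move=> tT; have sub : `[t0, t] `*` [set: Omega] `<=` J `*` [set: Omega].
  by move=> [s w] [/= st _]; split => //; exact: (subJ tT).
have mI : measurable (`[t0, t]%classic : set R) by exact: measurable_itv.
have mIO : measurable (`[t0, t]%classic `*` [set: Omega]) by exact: measurableX.
have mJO : measurable (J `*` [set: Omega]) by exact: measurableX.
apply: (@measurable_Rintegral_section _ _ _ P `[t0, t]%classic (fun p => a p.1 p.2)) => //.
- by apply: le_lt_trans Jfin; apply: le_measure; rewrite ?inE//; exact: subJ.
- exact: measurable_funS ma.
- apply: le_lt_trans a2; apply: ge0_subset_integral => //.
    by apply/measurable_EFinP; exact: measurable_funX.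
  by move=> p _; rewrite lee_fin sqr_ge0.
Qed.

(** Almost surely the difference is at most the integral over [t0, T] of the absolute remainder
    [D N] of the expansion. By [integral_section_le] its expectation is at most e |J| + V_N / e for
    every e > 0, with V_N the squared L2 error. *)
Lemma L1_cvg_K_a t (n : nat -> nat) : t0 <= t <= T ->
  (forall N j, (j < n N)%N -> measurable_fun setT (xi j)) ->
  (\int[(lam \x P)%E]_(p in J `*` [set: Omega])
     ((a p.1 p.2 - (mean_fun P a p.1 +
        \sum_(j < n N) Num.sqrt (nu j) * phi j p.1 * xi j p.2)) ^+ 2)%:E)%E
     @[N --> \oo] --> 0%E ->
  (\int[P]_w `|K_a P t0 a nu phi t (xi_vec xi (n N) w) -
     Rintegral lam `[t0, t] (fun s => a s w)|%:E)%E @[N --> \oo] --> 0%E.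
Proof.
move=> tT mxi.
pose D N (p : R * Omega) := a p.1 p.2 - (mean_fun P a p.1 +
  \sum_(j < n N) Num.sqrt (nu j) * phi j p.1 * xi j p.2).
pose V N := (\int[(lam \x P)%E]_(p in J `*` [set: Omega]) (D N p ^+ 2)%:E)%E.
rewrite -/(V _) => V0.
have mJO : measurable (J `*` [set: Omega]) by exact: measurableX.
have mI : measurable (`[t0, t]%classic : set R) by exact: measurable_itv.
have mI' : @measurable _ (measurableTypeR R) `[t0, t]%classic by exact: mI.
have mJ' : @measurable _ (measurableTypeR R) J by exact: mJ.
have mD N : measurable_fun (J `*` [set: Omega]) (D N).
  apply: measurable_funB => //; apply: measurable_funD.
    apply: measurable_fun_fst_on => //; apply/measurable_EFinP.
    exact: measurable_int intmean.
  apply: measurable_sum => j; apply: measurable_funM.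
    by apply: measurable_funM => //; exact: measurable_fun_fst_on.
  apply: measurable_funTS; apply: measurableT_comp => //; exact: (mxi N).
have mK := measurable_exponent tT.
have mxv N : measurable_fun setT (xi_vec xi (n N)).
  apply/measurable_fun_tnthP => j; rewrite (_ : _ \o _ = xi j); first exact: (mxi N).
  by apply/funext => w /=; rewrite tnth_mktuple.
pose U N := (\int[P]_w `|K_a P t0 a nu phi t (xi_vec xi (n N) w) -
     Rintegral lam `[t0, t] (fun s => a s w)|%:E)%E.
have mU N : measurable_fun setT (fun w => `|K_a P t0 a nu phi t (xi_vec xi (n N) w) -
     Rintegral lam `[t0, t] (fun s => a s w)|%:E).
  apply/measurable_EFinP; apply: measurableT_comp => //; apply: measurable_funB; last exact: mK.
  exact: (measurableT_comp (@measurable_K_a t (n N) tT) (mxv N)).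
have UV N (e : R) : (V N < +oo)%E -> 0 < e -> (U N <= e%:E * lam J + e^-1%:E * V N)%E.
  move=> VN e0; apply: le_trans (integral_section_le mJ Jfin (mD N) VN e0).
  apply: ae_ge0_le_integral => //.
  - by move=> w _; exact: integral_ge0.
  - exact: (measurable_integral_section mJ Jfin (mD N) VN).
  (* Subtracting under [Rintegral] requires an integrable path s -> a s w, which is available for
     almost every [w] only; hence the almost everywhere comparison. *)
  have := ae_integrable_section mJ Jfin ma a2; apply: filterS => w /= aw _.
  pose v := xi_vec xi (n N) w.
  have [ti _] := integrable_trunc v mI (subJ tT).
  have [tJ _] := integrable_trunc v mJ (@subset_refl _ J).
  have DE s : D N (s, w) = a s w - trunc s v.
    by rewrite /D /trunc/=; congr (_ - (_ + _)); apply: eq_bigr => j _; rewrite tnth_mktuple.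
  have aI : lam.-integrable `[t0, t] (fun s => (a s w)%:E) by exact: integrableI.
  have iB : lam.-integrable `[t0, t] (EFin \o (fun s => a s w - trunc s v)).
    by have := integrableB mI' aI ti; exact: eq_integrable.
  have mB : measurable_fun J (fun s => (a s w - trunc s v)%:E).
    by have := integrableB mJ' aw tJ; move=> /measurable_int.
  have -> : K_a P t0 a nu phi t (xi_vec xi (n N) w) =
    Rintegral lam `[t0, t] (fun s => trunc s v) by [].
  rewrite distrC -RintegralB// EFin_normr_Rintegral//.
  apply: le_trans (le_abse_integral _ mI' _) _; first exact: measurable_int iB.
  apply: (@le_trans _ _ (\int[lam]_(s in J) `|a s w - trunc s v|%:E)%E).
    apply: ge0_subset_integral => //; last exact: subJ.
    by apply: measurableT_comp => //; exact: mB.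
  by under [leRHS]eq_integral do rewrite DE.
pose l := fine (lam J).
have lE : (l%:E = lam J)%E by rewrite fineK// ge0_fin_numE.
have l0 : 0 <= l by exact: fine_ge0.
apply: cvge0_ge0 => [N|e e0]; first by apply: integral_ge0 => w _; rewrite lee_fin.
(* Chosen so that eps * l <= e / 2, while V_N < eps * e / 2 makes the other term at most e / 2. The
   1 added to [l] keeps the denominator positive. *)
pose eps := e / (2 * (l + 1)).
have l1 : 0 < l + 1 by exact: ltr_wpDl.
have eps0 : 0 < eps by rewrite divr_gt0// mulr_gt0.
have ee0 : (0%E < (eps * (e / 2))%:E :> \bar R)%E.
  by rewrite lte_fin mulr_gt0// divr_gt0.
have nearV : \forall N \near \oo, (V N < (eps * (e / 2))%:E)%E.
  exact: V0 _ (open_ereal_lt' ee0).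
apply: filterS nearV => N VN.
apply: le_trans (UV N eps (lt_trans VN (ltry _)) eps0) _.
rewrite -lE (splitr e) EFinD; apply: leeD.
  have -> : e / 2 = eps * (l + 1) by rewrite /eps invfM mulrA divfK// gt_eqF.
  by rewrite -EFinM lee_fin ler_pM2l// lerDl.
apply: (@le_trans _ _ (eps^-1%:E * (eps * (e / 2))%:E)%E).
  by apply: lee_wpmul2l; [rewrite lee_fin invr_ge0 ltW|exact: ltW].
by rewrite -EFinM mulKf// gt_eqF.
Qed.
End truncated_exponent.

(** * The domain D(x0) and densities glued along it *)

Section density_domain.
Context {R : realType} {d : measure_display} {Omega : measurableType d}.
Context (P : probability Omega R) (x0 : Omega -> R).
Local Notation lam := (@lebesgue_measure R).

(* At x = 0 the integrand f0 (x e^-k) e^-k is f0 0 e^-k, so the limit is taken there as on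
   Dx0, whether or not 0 belongs to Dx0. *)
Definition Dx0_with0 : set R := Dx0 P x0 `|` [set 0].

Lemma Dx0_scale y k : Dx0 P x0 y -> Dx0 P x0 (y * expR k).
Proof.
by move=> [p q]; split => [/p y0|/q y0]; rewrite ?pmulr_lgt0 ?pmulr_llt0 ?expR_gt0.
Qed.

Lemma Dx0_with0_scale y k : Dx0_with0 (y * expR k) <-> Dx0_with0 y.
Proof.
have H z l : Dx0_with0 z -> Dx0_with0 (z * expR l).
  by move=> [/Dx0_scale zl|->]; [left|right; rewrite /= mul0r].
split; last exact: H.
by move=> /(H _ (- k)); rewrite -mulrA -expRD subrr expR0 mulr1.
Qed.

(** The almost sure sign conditions do not involve y; deciding them classically exhibits the set as
    an intersection of open sets. *)
Lemma Dx0E : Dx0 P x0 =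
  (if `[< {ae P, forall w, 0 < x0 w} >] then `]0, +oo[%classic else setT) `&`
  (if `[< {ae P, forall w, x0 w < 0} >] then `]-oo, 0[%classic else setT).
Proof.
by apply/seteqP; split=> y; rewrite /Dx0 /=; case: asboolP => p; case: asboolP => q /=;
  rewrite ?in_itv/= ?andbT; intuition.
Qed.

Lemma open_Dx0 : open (Dx0 P x0).
Proof.
rewrite Dx0E; apply: openI; case: ifP => _; try exact: openT; exact: interval_open.
Qed.

Lemma measurable_Dx0_with0 : measurable Dx0_with0.
Proof. by apply: measurableU => //; apply: open_measurable; exact: open_Dx0. Qed.

Lemma Dx0_ae : {ae P, forall w, Dx0 P x0 (x0 w)}.
Proof.
have h1 : {ae P, forall w, {ae P, forall w, 0 < x0 w} -> 0 < x0 w}.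
  have [p|np] := pselect {ae P, forall w, 0 < x0 w}; first by apply: filterS p.
  by apply: aeW => w /np.
have h2 : {ae P, forall w, {ae P, forall w, x0 w < 0} -> x0 w < 0}.
  have [p|np] := pselect {ae P, forall w, x0 w < 0}; first by apply: filterS p.
  by apply: aeW => w /np.
by apply: filterS2 h1 h2 => w; split.
Qed.

(** Almost surely x0 lies in D(x0), and multiplication by a positive number does not leave D(x0). *)
Lemma Dx0_with0_compl_null (K : Omega -> R) (A : set R) :
  measurable_fun setT (fun w => x0 w * expR (K w)) -> measurable A -> A `<=` ~` Dx0_with0 ->
  P ((fun w => x0 w * expR (K w)) @^-1` A) = 0%E.
Proof.
move=> mX mA AD; have [N [mN N0 sub]] := Dx0_ae.
apply/eqP; rewrite -measure_le0 -N0 le_measure ?inE//.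
  by rewrite -[X in measurable X]setTI; exact: mX.
move=> w /AD /= nD; apply: sub => /= Dw; apply: nD.
by left; exact: Dx0_scale.
Qed.

Context (f0 : R -> R).
Context (df0 : is_density P x0 f0).

Let mx0 : measurable_fun setT x0. Proof. by case: df0. Qed.
Let mf0 : measurable_fun setT f0. Proof. by case: df0 => _ []. Qed.
Let f00 x : 0 <= f0 x. Proof. by case: df0 => _ [_ []]. Qed.

Lemma measurable_support_compl : measurable [set y | ~ Dx0_with0 y /\ f0 y != 0].
Proof.
rewrite (_ : [set _ | _] = ~` Dx0_with0 `&` (f0 @^-1` [set~ 0])); last first.
  by apply/seteqP; split=> y /= [? /eqP ?].
apply: measurableI; first by apply: measurableC; exact: measurable_Dx0_with0.
by rewrite -[X in measurable X]setTI; apply: mf0 => //; exact: measurableC.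
Qed.

(** With K = 0 the preceding lemma says that x0 has no mass off [Dx0_with0], so the nonnegative [f0]
    has integral 0 there. *)
Lemma null_support_compl : lam [set y | ~ Dx0_with0 y /\ f0 y != 0] = 0%E.
Proof.
have mD := measurable_Dx0_with0.
have mx0' : measurable_fun setT (fun w => x0 w * expR (cst 0 w)).
  by apply: measurable_funM => //; exact: measurableT_comp.
have := Dx0_with0_compl_null mx0' (measurableC mD) (@subset_refl _ _).
have -> : (fun w => x0 w * expR (cst 0 w)) = x0 by apply/funext => w; rewrite /cst expR0 mulr1.
have [_ [_ [_ ->]]] := df0; last exact: measurableC.
move=> I0.
have : ae_eq lam (~` Dx0_with0) (EFin \o f0) (cst 0%E).
  apply/ae_eq_integral_abs; first exact: measurableC.
    by apply: measurable_funTS; exact/measurable_EFinP.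
  by rewrite -[RHS]I0; apply: eq_integral => y _; rewrite gee0_abs// lee_fin.
move=> [N [mN N0 sub]]; apply/eqP; rewrite -measure_le0 -N0 le_measure ?inE//.
  exact: measurable_support_compl.
move=> y /= [Dy f0y]; apply: sub => /= /(_ Dy) [] /eqP.
by rewrite (negPf f0y).
Qed.

Lemma continuous_scaled_density x : {within Dx0 P x0, continuous f0} -> Dx0_with0 x ->
  continuous (fun k => f0 (x * expR (- k)) * expR (- k)).
Proof.
move=> cf0 Dx k.
have ce : {for k, continuous (fun k : R => expR (- k))}.
  by apply: continuous_comp; [exact: continuousN|exact: continuous_expR].
apply: (@continuousM _ _ (fun k => f0 (x * expR (- k))) (fun k => expR (- k))) => //.
case: Dx => [Dx|->]; last first.
  rewrite (_ : (fun k => _) = cst (f0 0)); first exact: cst_continuous.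
  by apply/funext => l; rewrite mul0r.
apply: (@continuous_comp _ _ _ (fun k => x * expR (- k)) f0).
  by apply: (@continuousM _ _ (cst x) (fun k => expR (- k))) => //; exact: cst_continuous.
(* Openness turns continuity within D(x0) into ordinary continuity at x e^-k, a point of D(x0). *)
move: cf0; rewrite continuous_open_subspace; last exact: open_Dx0.
by apply; rewrite inE; exact: Dx0_scale.
Qed.

Lemma bounded_scaled_density x : (exists M, forall y, Dx0 P x0 y -> `|f0 y| <= M) ->
  Dx0_with0 x ->
  exists M, forall k, 0 <= f0 (x * expR (- k)) * expR (- k) <= M * expR (- k).
Proof.
move=> [M fM] Dx.
suff [M' H] : exists M', forall k, f0 (x * expR (- k)) <= M'.
  exists M' => k; rewrite mulr_ge0 ?expR_ge0//=; apply: ler_wpM2r => //; exact: expR_ge0.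
case: Dx => [Dx|->]; last by exists (f0 0) => k; rewrite mul0r.
exists M => k; apply: le_trans (ler_norm _) _; apply: fM; exact: Dx0_scale.
Qed.

(** The function [e] is left free: x0 e^K has no mass off [Dx0_with0], so any nonnegative measurable
    values of integral zero may be prescribed there, in particular the pointwise limits of [f1N]. *)
Lemma is_density_scaled (K : Omega -> R) (e : R -> R) :
  measurable_fun setT K -> indep_rv P x0 K ->
  (forall x, Dx0_with0 x ->
    (\int[P]_w (f0 (x * expR (- K w)) * expR (- K w))%:E < +oo)%E) ->
  measurable_fun setT e -> (forall x, 0 <= e x) ->
  (\int[lam]_(x in ~` Dx0_with0) (e x)%:E = 0)%E ->
  is_density P (fun w => x0 w * expR (K w))
    (fun x => if x \in Dx0_with0
              then fine (\int[P]_w (f0 (x * expR (- K w)) * expR (- K w))%:E)%E else e x).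
Proof.
move=> mK iK fin me e0 eD; have mD := measurable_Dx0_with0.
have mX : measurable_fun setT (fun w => x0 w * expR (K w)).
  by apply: measurable_funM => //; exact: measurableT_comp.
pose G (p : R * Omega) := (f0 (p.1 * expR (- K p.2)) * expR (- K p.2))%:E.
have mE : measurable_fun setT (fun p : R * Omega => expR (- K p.2)).
  by apply: measurableT_comp => //; apply: measurableT_comp => //; exact: measurableT_comp.
have mG : measurable_fun setT G.
  apply/measurable_EFinP; apply: measurable_funM => //; apply: measurableT_comp => //.
  exact: measurable_funM.
have G0 p : (0 <= G p)%E by rewrite lee_fin mulr_ge0// expR_ge0.
have mF : measurable_fun setT (fubini_F P G) by exact: measurable_fun_fubini_tonelli_F.
have F0 x : (0 <= fubini_F P G x)%E by exact: integral_ge0.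
set f1 := (X in is_density _ _ X).
have f1_ge0 x : 0 <= f1 x.
  by rewrite /f1; case: ifP => // _; exact/fine_ge0/F0.
have mf1 : measurable_fun setT f1.
  apply: measurable_fun_ifT => //.
    by apply: (measurable_fun_bool true); rewrite setTI (_ : _ @^-1` _ = Dx0_with0)//;
      apply/seteqP; split => [x /set_mem|x /mem_set].
  by apply: (measurableT_comp (f := fine)) => //; exact: mF.
split => //; split => //; split => // A mA.
have mAD : measurable (A `&` Dx0_with0) by exact: measurableI.
have mAC : measurable (A `&` ~` Dx0_with0) by apply: measurableI => //; exact: measurableC.
have disj : [disjoint A `&` Dx0_with0 & A `&` ~` Dx0_with0].
  by apply/disj_setPLR => x [_ Dx] [_ /(_ Dx)].
have split_A : A = (A `&` Dx0_with0) `|` (A `&` ~` Dx0_with0).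
  by rewrite -setIUr setUv setIT.
rewrite [in RHS]split_A ge0_integral_setU//; last 2 first.
- by apply: measurable_funTS; exact/measurable_EFinP.
- by move=> x _; rewrite lee_fin.
(* The part of [A] off [Dx0_with0] contributes 0 to both sides: here by the assumption on [e], below
   because x0 e^K has no mass there. *)
rewrite [X in (_ + X)%E](_ : _ = 0%E); last first.
  apply/eqP; rewrite eq_le integral_ge0 ?andbT; last by move=> x _; rewrite lee_fin.
  rewrite -[leRHS]eD.
  have -> : (\int[lam]_(x in A `&` ~` Dx0_with0) (f1 x)%:E =
      \int[lam]_(x in A `&` ~` Dx0_with0) (e x)%:E)%E.
    by apply: eq_integral => x; rewrite inE => -[_ Dx]; rewrite /f1 memNset.
  apply: ge0_subset_integral => //; first exact: measurableC.
    by apply: measurable_funTS; exact/measurable_EFinP.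
  by move=> x _; rewrite lee_fin.
rewrite adde0 [in LHS]split_A preimage_setU measureU//; last 3 first.
- by rewrite -[X in measurable X]setTI; exact: mX.
- by rewrite -[X in measurable X]setTI; exact: mX.
- by rewrite -preimage_setI; move/disj_setPS: disj; rewrite subset0 => ->; rewrite preimage_set0.
rewrite [X in (_ + X)%E](_ : _ = 0%E); last exact: Dx0_with0_compl_null.
rewrite adde0; apply: etrans (scaled_density_law df0 mK iK mAD) _.
apply: eq_integral => x; rewrite inE => -[_ Dx].
rewrite /f1 mem_set// fineK// ge0_fin_numE; first exact: fin.
exact: F0.
Qed.
End density_domain.

Theorem theorem7 (R : realType) (d : measure_display) (Omega : measurableType d)
  (P : probability Omega R) (t0 T : R) (x0 : Omega -> R) (a : R -> Omega -> R)
  (L : option nat) (nu : nat -> R) (phi : nat -> R -> R) (xi : nat -> Omega -> R)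
  (f0 : R -> R) (fxi : forall N : nat, (neff L N).-tuple R -> R) :
  measure_is_complete P ->
  t0 < T ->
  (* (H1) a in L^2([t0,T] x Omega) *)
  measurable_fun (`[t0, T] `*` [set: Omega]) (fun p : R * Omega => a p.1 p.2) ->
  (\int[(@lebesgue_measure R \x P)%E]_(p in `[t0, T] `*` [set: Omega])
      (a p.1 p.2 ^+ 2)%:E < +oo)%E ->
  (* Karhunen-Loeve expansion of a *)
  KL_expansion P t0 T a L nu phi xi ->
  (* (H2) *)
  (forall N, (1 <= N)%N ->
     (exists g, is_density P x0 g) /\
     (exists g, is_density_vec P (xi_vec xi (neff L N)) g) /\
     indep_rv_vec P x0 (xi_vec xi (neff L N))) ->
  (forall N, (1 <= N)%N -> is_density_vec P (xi_vec xi (neff L N)) (fxi N)) ->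
  (* (H3) f0 is the density of x0, continuous and bounded on D(x0) *)
  is_density P x0 f0 ->
  {within Dx0 P x0, continuous f0} ->
  (exists M : R, forall y, Dx0 P x0 y -> `|f0 y| <= M) ->
  (* (H4) *)
  (exists C : R, forall N, (1 <= N)%N -> forall t, t0 <= t <= T ->
     ('N[P]_2%:E[(fun w => (expR (- K_a P t0 a nu phi t (xi_vec xi (neff L N) w)))%:E)]
        <= C%:E)%E) ->
  forall t, t0 <= t <= T ->
  exists f1 : R -> R,
    is_density P (sol t0 x0 a t) f1 /\
    forall x : R,
      (fun N => f1N P t0 a nu phi f0 (fxi N) x t) @ \oo --> (f1 x)%:E.
Proof.
move=> _ _ ma a2 KL H2 dxi df0 cf0 bf0 [C H4] t tT.
have [_ [_ [_ [_ [mphi [ophi [_ [_ [mxi [_ [_ [_ KLcvg]]]]]]]]]]]] := KL.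
have [mx0 [mf0 [f00 _]]] := df0.
have phi2 j : (\int[@lebesgue_measure R]_(s in `[t0, T]) (phi j s ^+ 2)%:E < +oo)%E.
  by have := ophi j j; rewrite eqxx => ->; rewrite ltry.
have active_neff N j : (j < neff L N)%N -> active L j.
  by rewrite /neff /active; case: (L) => // M; rewrite leq_min => /andP[].
pose c0 := Rintegral lebesgue_measure `[t0, t] (mean_fun P a).
pose c j := Num.sqrt (nu j) * Rintegral lebesgue_measure `[t0, t] (phi j).
have KE n (v : n.-tuple R) : K_a P t0 a nu phi t v = c0 + \sum_(j < n) c j * tnth v j.
  exact: (K_aE nu mphi phi2 ma a2).
have mK n : measurable_fun setT (fun v : n.-tuple R => K_a P t0 a nu phi t v).
  exact: (measurable_K_a nu mphi phi2 ma a2).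
pose Y w := Rintegral lebesgue_measure `[t0, t] (fun s => a s w).
have mY : measurable_fun setT Y by exact: (measurable_exponent ma a2).
(* Indexed by [N.+1] because the hypotheses on truncations start at N = 1. *)
pose Y_ N w := K_a P t0 a nu phi t (xi_vec xi (neff L N.+1) w).
have mY_ N : measurable_fun setT (Y_ N).
  have [mxv _] := dxi N.+1 isT; exact: (measurableT_comp (mK _) mxv).
have YY : (\int[P]_w `|Y_ N w - Y w|%:E)%E @[N --> \oo] --> 0%E.
  pose u N := (\int[P]_w `|K_a P t0 a nu phi t (xi_vec xi (neff L N) w) - Y w|%:E)%E.
  have cu : u @ \oo --> 0%E.
    apply: (L1_cvg_K_a mphi phi2 ma a2 tT _ KLcvg) => N j /active_neff; exact: mxi.
  exact: ((cvg_succn u 0%E).2 cu).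
have indY_ N : indep_rv P x0 (Y_ N).
  have [_ [_ ind]] := H2 N.+1 isT; move=> A B mA mB.
  apply: (ind A ((fun v => K_a P t0 a nu phi t v) @^-1` B) mA).
  by rewrite -[X in measurable X]setTI; exact: mK.
have indY := indep_rv_L1_limit mx0 mY_ mY YY indY_.
have EC N : (\int[P]_w (expR (- Y_ N w) ^+ 2)%:E <= (C ^+ 2)%:E)%E.
  by apply: integral_sqr_le_Lnorm2; exact: H4.
pose g x k := f0 (x * expR (- k)) * expR (- k).
have mg x : measurable_fun setT (g x).
  have me : measurable_fun setT (fun k : R => expR (- k)).
    by apply: measurableT_comp => //; exact: measurableT_comp.
  by apply: measurable_funM => //; apply: measurableT_comp => //; exact: measurable_funM.
have g0 x k : 0 <= g x k by rewrite mulr_ge0// expR_ge0.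
have f1NE N x : f1N P t0 a nu phi f0 (fxi N.+1) x t = (\int[P]_w (g x (Y_ N w))%:E)%E.
  rewrite (expectation_density_vec (g := fun v => g x (K_a P t0 a nu phi t v)) (dxi N.+1 isT))//.
    by rewrite /f1N; congr iter_int; apply/funext => v; rewrite /g mulrAC.
  exact: (measurableT_comp (mg x) (mK _)).
have cvgD x : Dx0_with0 P x0 x -> (\int[P]_w (g x (Y w))%:E < +oo)%E /\
    (\int[P]_w (g x (Y_ n w))%:E)%E @[n --> \oo] --> (\int[P]_w (g x (Y w))%:E)%E.
  move=> Dx; have [M gM] := bounded_scaled_density df0 bf0 Dx.
  exact: (cvg_integral_expRN_dominated mY_ mY YY EC (continuous_scaled_density cf0 Dx) gM).
have finD x : Dx0_with0 P x0 x -> (\int[P]_w (g x (Y w))%:E)%E \is a fin_num.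
  move=> /cvgD[fin _]; rewrite ge0_fin_numE//.
  by apply: integral_ge0 => w _; rewrite lee_fin.
(* Off Dx0 the density f0 is only known to vanish almost everywhere, but f1N must converge
   at every x. If all coefficients of the exponent vanish, f1N does not depend on N;
   otherwise the exponent eventually has a density and f1N is 0. *)
suff [e [me e0 eD ecvg]] : exists e : R -> R, [/\ measurable_fun setT e, forall x, 0 <= e x,
    (\int[lebesgue_measure]_(x in ~` Dx0_with0 P x0) (e x)%:E = 0)%E &
    forall x, ~ Dx0_with0 P x0 x ->
      f1N P t0 a nu phi f0 (fxi N.+1) x t @[N --> \oo] --> (e x)%:E].
  eexists; split.
    exact: (is_density_scaled df0 mY indY (fun x Dx => (cvgD x Dx).1) me e0 eD).
  move=> x; apply/cvg_succn; have [Dx|nDx] := pselect (Dx0_with0 P x0 x); last first.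
    by rewrite memNset//; exact: ecvg.
  by under eq_fun do rewrite f1NE; rewrite mem_set// (fineK (finD x Dx)); exact: (cvgD x Dx).2.
have [cz|/existsNP[j0 /not_implyP[aj0 /eqP cj0]]] := pselect (forall j, active L j -> c j = 0).
  have YE N w : Y_ N w = c0.
    by rewrite /Y_ KE big1 ?addr0// => j _; rewrite cz ?mul0r//; exact: active_neff (ltn_ord j).
  pose e x := g x c0.
  have me : measurable_fun setT e.
    apply: measurable_funM => //; apply: measurableT_comp => //; exact: measurable_funM.
  (* A constant is independent of x0, so the scaling law applies with exponent [c0]: the integral of
     [e] off [Dx0_with0] is the probability that x0 e^c0 falls there, which is 0. *)
  have ic : indep_rv P x0 (cst c0).
    move=> A B mA mB; rewrite !preimage_cst; case: ifP => _; rewrite ?setIT ?setI0 ?measure0 ?mule0//.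
    by rewrite probability_setT mule1.
  have eD : (\int[lebesgue_measure]_(x in ~` Dx0_with0 P x0) (e x)%:E = 0)%E.
    have mDC : measurable (~` Dx0_with0 P x0) by apply: measurableC; exact: measurable_Dx0_with0.
    have := scaled_density_law df0 (measurable_cst c0) ic mDC.
    rewrite Dx0_with0_compl_null//; last by apply: measurable_funM => //; exact: measurableT_comp.
    move=> E0; rewrite [RHS]E0; apply: eq_integral => x _.
    transitivity (\int[P]_w (e x)%:E)%E; last by [].
    by rewrite integral_cst//= probability_setT mule1.
  exists e; split => // [x|x _]; first exact: g0.
  under eq_fun do rewrite f1NE.
  apply: cvg_near_cst; apply: nearW => N.
  under eq_integral do rewrite YE.
  by rewrite integral_cst//= probability_setT mule1.
exists (cst 0); split => //; first exact: integral0_eq.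
move=> x nDx; apply: cvg_near_cst; near=> N.
have jN : (j0 < neff L N.+1)%N.
  have : (j0 <= N)%N by near: N; exact: nbhs_infty_ge.
  by move: aj0; rewrite /active /neff; case: (L) => [M|] // jM jN; rewrite leq_min jM ltnS jN.
(* Nonzero [x] is what makes the preimage of a null set under k -> x e^-k null. *)
have x_neq0 : x != 0 by apply: contra_notN nDx => /eqP ->; right.
pose Z := [set y | ~ Dx0_with0 P x0 y /\ f0 y != 0].
have mZ : measurable Z by exact: measurable_support_compl.
have Z0 : lebesgue_measure Z = 0%E by exact: null_support_compl.
have [_ [mfx [fx0 _]]] := dxi N.+1 isT.
(* With [x] also x e^-k stays off [Dx0_with0], so the integrand vanishes unless x e^-K_N lies in the
   null set [Z]; coordinate [j0] has a nonzero coefficient in K_N. *)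
apply: (iter_int_affine_null (b := c0) (c := fun j => c j) (S := [set k | Z (x * expR (- k))])).
- rewrite -[X in measurable X]setTI; apply: (_ : measurable_fun setT _) => //.
  by apply: measurable_funM => //; apply: measurableT_comp => //; exact: measurableT_comp.
- exact: lebesgue_null_log.
- by exists (Ordinal jN).
- apply/measurable_EFinP; apply: (eq_measurable_fun (fun v => g x (K_a P t0 a nu phi t v) * fxi N.+1 v)).
    by move=> v _; rewrite /g mulrAC.
  by apply: measurable_funM => //; exact: (measurableT_comp (mg x) (mK _)).
- by move=> v; rewrite lee_fin !mulr_ge0// expR_ge0.
move=> v; rewrite -KE /Z/= => nZ; congr EFin.
suff -> : f0 (x * expR (- K_a P t0 a nu phi t v)) = 0 by rewrite !mul0r.
apply/eqP; apply: contra_notT nZ => f0n; split => //.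
by rewrite Dx0_with0_scale.
Unshelve. all: by end_near.
Qed.
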